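(* Let $A$ be a finite-dimensional unital associative algebra over a field $k$ with a non-degenerate, symmetric, invariant bilinear form $\eta$. Then the normalized Hochschild cochains $\overline{CH}(A,A)=\bigoplus_n\overline{CH}^n(A,A)$ are a BV algebra up to homotopy.
   Context: $\eta:A\otimes A\to k$ is invariant if $\eta(ab,c)=\eta(a,bc)$ and symmetric if $\eta(a,b)=\eta(b,a)$. $CH^n(A,A)=Hom(A^{\otimes n},A)$ with the Hochschild differential $\partial$; the normalized cochains $\overline{CH}^n(A,A)$ are those vanishing on any tensor containing $1\in A$ as a factor; $|f|=n$ for $f\in\overline{CH}^n(A,A)$. The product is the cup product $(f\cup g)(a_1,\dots,a_{n+m})=f(a_1,\dots,a_n)g(a_{n+1},\dots,a_{n+m})$ (written $fg$; up to the usual sign convention). The BV operator $\Delta:\overline{CH}^n(A,A)\to\overline{CH}^{n-1}(A,A)$ is the operator dual to Connes' operator $B$, determined by $$\eta(a_0,(\Delta f)(a_1,\dots,a_{n-1}))=\eta(1,f\circ N(a_0,\dots,a_{n-1})),$$ where $N=1+t+\dots+t^{n-1}$ and $t(a_1,\dots,a_n)=(-1)^{n-1}(a_n,a_1,\dots,a_{n-1})$ on $A^{\otimes n}$. It satisfies $\Delta^2=0$ and $\Delta\partial+\partial\Delta=0$. ''BV algebra up to homotopy'' means: with respect to $\partial$ these operations satisfy the relations of a Batalin–Vilkovisky algebra up to chain homotopy: $\cup$ is associative and graded commutative up to homotopy, $\Delta^2\sim 0$, and $$\Delta(abc)\sim\Delta(ab)c+(-1)^{|a|}a\Delta(bc)+(-1)^{(|a|+1)|b|}b\Delta(ac)-\Delta(a)bc-(-1)^{|a|}a\Delta(b)c-(-1)^{|a|+|b|}ab\Delta(c),$$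 where $\sim$ means equality up to a chain homotopy of multilinear operations on $\overline{CH}(A,A)$. *)

(* Defs.v *)
From HB Require Import structures.
From mathcomp Require Import all_boot all_order all_algebra all_field.
From mathcomp Require Import boolp functions.

Set Implicit Arguments.
Unset Strict Implicit.
Unset Printing Implicit Defensive.

Import GRing.Theory.

Local Open Scope ring_scope.

(* V is a graded k-module, hom n v meaning that v is homogeneous of degree n,
   and d is a differential of degree +1.  An operation of arity r may involve
   signs depending on the degrees n, m, p of its arguments, and is therefore
   given as a function of these degrees and of the arguments.  An operation of
   degree e with values Phi is homotopic to Psi if there is a multilinear H of
   degree e - 1 with Phi - Psi = d H - (-1)^(e - 1) H d, where d acts on
   a tensor product by the Koszul rule. *)
Section GradedOperations.
Variables (k : fieldType) (V : lmodType k) (hom : int -> V -> Prop).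
Variable d : V -> V.
Implicit Types (n m p e : int) (a b c : V).

Definition bilin (H : V -> V -> V) : Prop :=
  (forall b, linear (fun a => H a b)) /\ (forall a, linear (fun b => H a b)).

Definition trilin (H : V -> V -> V -> V) : Prop :=
  [/\ forall b c, linear (fun a => H a b c),
      forall a c, linear (fun b => H a b c) &
      forall a b, linear (fun c => H a b c)].

Definition degree1 e (H : V -> V) : Prop :=
  forall n a, hom n a -> hom (n + e) (H a).

Definition degree2 e (H : V -> V -> V) : Prop :=
  forall n m a b, hom n a -> hom m b -> hom (n + m + e) (H a b).

Definition degree3 e (H : V -> V -> V -> V) : Prop :=
  forall n m p a b c, hom n a -> hom m b -> hom p c ->
  hom (n + m + p + e) (H a b c).

Definition homotopic1 e (Phi Psi : int -> V -> V) : Prop :=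
  exists H : V -> V, [/\ linear H, degree1 (e - 1) H &
    forall n a, hom n a ->
      Phi n a - Psi n a = d (H a) + (-1) ^ e *: H (d a)].

Definition homotopic2 e (Phi Psi : int -> int -> V -> V -> V) : Prop :=
  exists H : V -> V -> V, [/\ bilin H, degree2 (e - 1) H &
    forall n m a b, hom n a -> hom m b ->
      Phi n m a b - Psi n m a b =
        d (H a b) + (-1) ^ e *: (H (d a) b + (-1) ^ n *: H a (d b))].

Definition homotopic3 e
    (Phi Psi : int -> int -> int -> V -> V -> V -> V) : Prop :=
  exists H : V -> V -> V -> V, [/\ trilin H, degree3 (e - 1) H &
    forall n m p a b c, hom n a -> hom m b -> hom p c ->
      Phi n m p a b c - Psi n m p a b c =
        d (H a b c) + (-1) ^ e *: (H (d a) b c + (-1) ^ n *: H a (d b) c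
                                   + (-1) ^ (n + m) *: H a b (d c))].

Record BV_up_to_homotopy (mul : V -> V -> V) (Delta : V -> V) : Prop := {
  BV_d_linear : linear d;
  BV_d_degree : degree1 1 d;
  BV_d_square : forall a, d (d a) = 0;
  BV_mul_bilin : bilin mul;
  BV_mul_degree : degree2 0 mul;
  BV_mul_chain : forall n m a b, hom n a -> hom m b ->
    d (mul a b) = mul (d a) b + (-1) ^ n *: mul a (d b);
  BV_Delta_linear : linear Delta;
  BV_Delta_degree : degree1 (- 1) Delta;
  BV_Delta_chain : forall a, Delta (d a) + d (Delta a) = 0;
  BV_assoc : homotopic3 0
    (fun _ _ _ a b c => mul (mul a b) c)
    (fun _ _ _ a b c => mul a (mul b c));
  BV_comm : homotopic2 0
    (fun _ _ a b => mul a b)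
    (fun n m a b => (-1) ^ (n * m) *: mul b a);
  BV_Delta_square : homotopic1 (- 2%:Z)
    (fun _ a => Delta (Delta a))
    (fun _ _ => 0);
  BV_seven_term : homotopic3 (- 1)
    (fun _ _ _ a b c => Delta (mul (mul a b) c))
    (fun n m _ a b c =>
        mul (Delta (mul a b)) c
      + (-1) ^ n *: mul a (Delta (mul b c))
      + (-1) ^ ((n + 1) * m) *: mul b (Delta (mul a c))
      - mul (mul (Delta a) b) c
      - (-1) ^ n *: mul (mul a (Delta b)) c
      - (-1) ^ (n + m) *: mul (mul a b) (Delta c))
}.

End GradedOperations.

(* An element of the direct sum of the normalized cochain spaces is encoded as
   one function f on sequences: its component in Hom(A^{(x) n}, A) is the
   restriction of f to sequences of length n, and all but finitely many of its
   components vanish. *)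
Section Cochains.
Variables (k : fieldType) (A : falgType k).
Implicit Types (f g : seq A -> A) (s : seq A) (x y : A) (c : k).

Definition multilinear f : Prop :=
  forall c x y s1 s2, f (s1 ++ (c *: x + y) :: s2) =
    c *: f (s1 ++ x :: s2) + f (s1 ++ y :: s2).

Definition normalized f : Prop := forall s1 s2, f (s1 ++ 1 :: s2) = 0.

Definition finite_degree f : Prop :=
  exists N : nat, forall s, (N <= size s)%N -> f s = 0.

Definition CHpred : {pred seq A -> A} :=
  fun f => `[< [/\ multilinear f, normalized f & finite_degree f] >].

Lemma CHpredP f :
  reflect [/\ multilinear f, normalized f & finite_degree f] (f \in CHpred).
Proof. exact: asboolP. Qed.

Lemma CHpred_submod : submod_closed CHpred.
Proof.
split=> [|c f g /CHpredP[mf nf [N hN]] /CHpredP[mg ng [M hM]]]; apply/CHpredP.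
  split=> // [c x y s1 s2|]; last by exists 0%N.
  by rewrite [RHS]addr0 [RHS]scaler0.
have fE s : (c *: f + g) s = c *: f s + g s by [].
split=> [e x y s1 s2|s1 s2|].
- rewrite !fE mf mg !scalerDr !scalerA mulrC -!addrA; congr (_ + _).
  by rewrite addrCA.
- by rewrite fE nf ng scaler0 addr0.
- exists (maxn N M) => s; rewrite geq_max => /andP[Ns Ms].
  by rewrite fE hN // hM // scaler0 addr0.
Qed.

HB.instance Definition _ :=
  GRing.isSubmodClosed.Build k (seq A -> A) CHpred CHpred_submod.

Record CHbar := CHbar_of { CHfun :> seq A -> A; _ : CHfun \in CHpred }.

HB.instance Definition _ := [isSub for CHfun].
HB.instance Definition _ := [Choice of CHbar by <:].
HB.instance Definition _ := [SubChoice_isSubLmodule of CHbar by <:].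

Definition CHdeg (n : int) (f : CHbar) : Prop :=
  forall s, (size s)%:Z != n -> f s = 0.

(* s = (a_1, ..., a_n) is indexed from 0: contract i s replaces the two adjacent
   entries a_i, a_(i+1) by their product. *)
Definition contract i s : seq A :=
  take i.-1 s ++ (s`_i.-1 * s`_i) :: drop i.+1 s.

Definition hochschild f s : A :=
  if s is [::] then 0 else
  s`_0 * f (behead s)
  + \sum_(1 <= i < size s) (-1) ^+ i *: f (contract i s)
  + (-1) ^+ size s *: (f (take (size s).-1 s) * s`_(size s).-1).

(* No sign (-1)^(|f| |g|): with that extra sign the seven-term relation fails for
   the operator Delta below. *)
Definition cupf f g s : A :=
  \sum_(i < (size s).+1) f (take i s) * g (drop i s).

(* f o N, where t^i (a_1, ..., a_n) is (-1)^(i (n - 1)) times the rotation of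
   (a_1, ..., a_n) bringing its last i entries to the front. *)
Definition cyclic_norm f s : A :=
  \sum_(i < size s) (-1) ^+ (i * (size s).-1) *: f (rotr i s).

(* eta_flat b is the linear form eta(-, b); it is invertible when eta is
   nondegenerate. *)
Definition eta_flat (eta : {symmetric A}) : 'Hom(A, 'Hom(A, k^o)) :=
  linfun (fun b => linfun (fun a => eta a b : k^o)).

Definition BVf (eta : {symmetric A}) f s : A :=
  (eta_flat eta)^-1%VF
    (linfun (fun a0 => eta 1 (cyclic_norm f (a0 :: s)) : k^o)).

Definition slot (g : A -> A) := forall c x y, g (c *: x + y) = c *: g x + g y.

Lemma slot_sum I (r : seq I) (P : pred I) (G : I -> A -> A) :
  (forall i, P i -> slot (G i)) -> slot (fun x => \sum_(i <- r | P i) G i x).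
Proof.
move=> sG c x y; rewrite scaler_sumr -big_split.
by apply: eq_bigr => i Pi; exact: sG.
Qed.

Lemma slotD (g h : A -> A) : slot g -> slot h -> slot (fun x => g x + h x).
Proof. by move=> sg sh c x y; rewrite sg sh scalerDr addrACA. Qed.

Lemma slotZ e (g : A -> A) : slot g -> slot (fun x => e *: g x).
Proof. by move=> sg c x y; rewrite sg scalerDr !scalerA mulrC. Qed.

Lemma slotMr (g : A -> A) u : slot g -> slot (fun x => g x * u).
Proof. by move=> sg c x y; rewrite sg mulrDl scalerAl. Qed.

Lemma slotMl (g : A -> A) u : slot g -> slot (fun x => u * g x).
Proof. by move=> sg c x y; rewrite sg mulrDr scalerAr. Qed.

Lemma slotf f s1 s2 (g : A -> A) :
  multilinear f -> slot g -> slot (fun x => f (s1 ++ g x :: s2)).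
Proof. by move=> mf sg c x y; rewrite sg mf. Qed.

Lemma normalized_mem f s : normalized f -> 1 \in s -> f s = 0.
Proof. by move=> nf /path.splitPr[s1 s2]; exact: nf. Qed.

Lemma cyclic_norm_slot f s1 s2 :
  multilinear f -> slot (fun x => cyclic_norm f (s1 ++ x :: s2)).
Proof.
move=> mf; pose n := (size s1 + size s2)%N.
have szE x : size (s1 ++ x :: s2) = n.+1 by rewrite size_cat /= addnS.
have rotE i : exists p q, forall x, rotr i (s1 ++ x :: s2) = p ++ x :: q.
  rewrite /rotr /rot; set m := (n.+1 - i)%N.
  case: (ltnP m (size s1)) => [lt_m|le_m].
    exists (drop m s1), (s2 ++ take m s1) => x.
    by rewrite szE -/m drop_cat take_cat lt_m -catA.
  case Em: (m - size s1)%N => [|m'].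
    exists [::], (s2 ++ s1) => x.
    by rewrite szE -/m drop_cat take_cat ltnNge le_m /= Em /= cats0.
  exists (drop m' s2 ++ s1), (take m' s2) => x.
  by rewrite szE -/m drop_cat take_cat ltnNge le_m /= Em /= -catA.
rewrite (_ : (fun x => _) = fun x => \sum_(i < n.+1)
    (-1) ^+ (i * n) *: f (rotr i (s1 ++ x :: s2))); last first.
  by apply/funext => x; rewrite /cyclic_norm szE.
apply: slot_sum => i _; apply: slotZ.
by have [p [q rE]] := rotE i; move=> c x y; rewrite !rE mf.
Qed.

Lemma cyclic_norm1 f s : normalized f -> 1 \in s -> cyclic_norm f s = 0.
Proof.
move=> nf s1; rewrite /cyclic_norm big1 // => i _.
by rewrite normalized_mem ?scaler0 // mem_rotr.
Qed.

Lemma contract_lt i s1 s2 x : (0 < i < size s1)%N ->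
  contract i (s1 ++ x :: s2) = contract i s1 ++ x :: s2.
Proof.
case: i => // i /= lt_i; rewrite /contract /= take_cat !nth_cat drop_cat lt_i.
rewrite (ltnW lt_i) -catA /=; congr (_ ++ _ :: _); case: ltnP => // le_j.
have <- : size s1 = i.+2 by apply/eqP; rewrite eqn_leq le_j lt_i.
by rewrite subnn drop_size.
Qed.

Lemma contract_eq s1 s2 a x :
  contract (size s1).+1 (rcons s1 a ++ x :: s2) = s1 ++ (a * x) :: s2.
Proof.
rewrite /contract /= take_cat !nth_cat drop_cat size_rcons ltnS leqnn ltnn subnn.
rewrite ltnNge leqnSn /= subSn // subnn /= drop0 nth_rcons ltnn eqxx.
by rewrite -cats1 take_size_cat.
Qed.

Lemma contract_eqS s1 s2 b x :
  contract (size s1).+1 (s1 ++ x :: b :: s2) = s1 ++ (x * b) :: s2.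
Proof.
rewrite /contract /= take_size_cat // !nth_cat ltnn subnn ltnNge leqnSn /=.
by rewrite subSnn /= drop_cat ltnNge (leqW (leqnSn _)) /= -addn2 addKn /= drop0.
Qed.

Lemma contract_gt i s1 s2 x : (0 < i)%N ->
  contract (size s1 + i.+1) (s1 ++ x :: s2) = s1 ++ x :: contract i s2.
Proof.
case: i => // i _; rewrite /contract !addnS /= take_cat !nth_cat drop_cat.
by rewrite !ltnNge -!addnS !leq_addr /= !addKn -catA.
Qed.

Lemma contractE s1 s2 i : (0 < i < (size s1 + size s2).+1)%N ->
  [\/ i = size s1, i = (size s1).+1 |
    exists p q, forall x, contract i (s1 ++ x :: s2) = p ++ x :: q].
Proof.
move=> /andP[i_gt0 lt_in].
case: (ltngtP i (size s1)) => [lt_i|gt_i|->]; last by constructor 1.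
  by constructor 3; exists (contract i s1), s2 => y; rewrite contract_lt ?i_gt0.
case: (ltngtP i (size s1).+1) => [|gt_i'|->]; last by constructor 2.
  by rewrite ltnS leqNgt gt_i.
constructor 3; exists s1, (contract (i - (size s1).+1) s2) => y.
by rewrite -contract_gt ?subn_gt0 // -addSnnS subnKC // ltnW.
Qed.

Lemma hochschildE f n s : size s = n.+1 ->
  hochschild f s = s`_0 * f (behead s)
    + \sum_(1 <= i < n.+1) (-1) ^+ i *: f (contract i s)
    + (-1) ^+ n.+1 *: (f (take n s) * s`_n).
Proof. by rewrite /hochschild; case: s => // a s ->. Qed.

Lemma take_cat_rcons s1 s2 b x :
  take (size s1 + size (rcons s2 b)) (s1 ++ x :: rcons s2 b) = s1 ++ x :: s2.
Proof.
rewrite take_cat ltnNge leq_addr addKn size_rcons /=.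
by rewrite -cats1 take_size_cat.
Qed.

Lemma hochschild_slot f s1 s2 :
  multilinear f -> slot (fun x => hochschild f (s1 ++ x :: s2)).
Proof.
move=> mf; pose n := (size s1 + size s2)%N.
have szE x : size (s1 ++ x :: s2) = n.+1 by rewrite size_cat /= addnS.
rewrite (_ : (fun x => _) = fun x => let s := s1 ++ x :: s2 in
    s`_0 * f (behead s) + \sum_(1 <= i < n.+1) (-1) ^+ i *: f (contract i s)
    + (-1) ^+ n.+1 *: (f (take n s) * s`_n)) /=; last first.
  by apply/funext => x; rewrite (hochschildE f (szE x)).
apply: slotD; first apply: slotD.
- case: {szE n} s1 => [|a s1] /=; first exact: slotMr.
  exact/slotMl/slotf.
- rewrite (_ : (fun x => _) = fun x => \sum_(i <- index_iota 1 n.+1 |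
      (0 < i < n.+1)%N) (-1) ^+ i *: f (contract i (s1 ++ x :: s2))); last first.
    by apply/funext => x; rewrite big_nat.
  apply: slot_sum => i lt_in; apply: slotZ.
  case: (contractE lt_in) => [Ei|Ei|[p [q mE]]]; last first.
  + by move=> c x y; rewrite !mE mf.
  + move: lt_in; rewrite {}Ei /n; clear szE n; case: s2 => [|b s2] lt_in.
      by rewrite addn0 ltnn andbF in lt_in.
    move=> c x y; rewrite !contract_eqS; move: c x y.
    by apply: slotf => //; exact: slotMr.
  + move: lt_in; rewrite {}Ei /n; clear szE n; case/lastP: s1 => [|s1 a] // _.
    rewrite size_rcons => c x y; rewrite !contract_eq; move: c x y.
    by apply: slotf => //; exact: slotMl.
- apply: slotZ; rewrite /n; clear szE n; case/lastP: s2 => [|s2 b].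
    rewrite addn0 => c x y; rewrite !take_size_cat // !nth_cat ltnn subnn /=.
    by move: c x y; exact: slotMl.
  have E' z : (s1 ++ z :: rcons s2 b)`_(size s1 + (size s2).+1) = b.
    by rewrite nth_cat ltnNge leq_addr addKn /= nth_rcons ltnn eqxx.
  move=> c x y; rewrite !take_cat_rcons size_rcons !E'; move: c x y; exact/slotMr/slotf.
Qed.

Lemma hochschild1 f s1 s2 : normalized f -> hochschild f (s1 ++ 1 :: s2) = 0.
Proof.
move=> nf; pose n := (size s1 + size s2)%N.
have szE : size (s1 ++ 1 :: s2) = n.+1 by rewrite size_cat /= addnS.
pose F i : A := if i == 0%N then (s1 ++ 1 :: s2)`_0 * f (behead (s1 ++ 1 :: s2))
  else if i == n.+1 then f (take n (s1 ++ 1 :: s2)) * (s1 ++ 1 :: s2)`_n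
  else f (contract i (s1 ++ 1 :: s2)).
have -> : hochschild f (s1 ++ 1 :: s2) = \sum_(i < n.+2) (-1) ^+ i *: F i.
  rewrite (hochschildE f szE) big_ord_recr /= {2}/F eqxx; congr (_ + _).
  rewrite -(big_mkord xpredT (fun i => (-1) ^+ i *: F i)).
  rewrite [RHS]big_ltn // scale1r; congr (_ + _).
  apply: eq_big_nat => i /andP[i_gt0 lt_in].
  by rewrite /F (gtn_eqF i_gt0) (ltn_eqF lt_in).
have le_jn : (size s1 <= n)%N by rewrite leq_addr.
have lt_j : (size s1 < n.+2)%N by rewrite ltnS (leq_trans le_jn).
have lt_j' : ((size s1).+1 < n.+2)%N by rewrite !ltnS.
have F1 : F (size s1) = f (s1 ++ s2).
  rewrite /F {F szE}; case/lastP: s1 @n le_jn lt_j lt_j' => [|s1 a] n le_jn _ _.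
    by rewrite /= mul1r.
  rewrite size_rcons /= ltn_eqF; last by rewrite -(size_rcons s1 a).
  by rewrite contract_eq mulr1 cat_rcons.
have F2 : F (size s1).+1 = f (s1 ++ s2).
  rewrite /F /= eqSS {F szE F1 lt_j lt_j' le_jn}/n.
  case: s2 => [|b s2]; last first.
    by rewrite /= addnS ltn_eqF ?ltnS ?leq_addr // contract_eqS mul1r.
  rewrite addn0 eqxx take_size_cat // nth_cat ltnn subnn cats0 /=.
  by rewrite mulr1.
have F3 i : (i < n.+2)%N -> i != size s1 -> i != (size s1).+1 -> F i = 0.
  rewrite /F ltnS leq_eqVlt => lt_in ij ij'.
  case: eqP => [i0|/eqP i0].
    have := ij; rewrite i0; case: (s1) => // a s _ /=.
    by rewrite nf mulr0.
  have [/eqP i_n|ne_in] := boolP (i == n.+1).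
    move: ij'; rewrite {}i_n eqSS /n {ij lt_in szE F1 F2 F lt_j lt_j' le_jn i0}.
    case/lastP: s2 @n => [|s2 b] n; first by rewrite addn0 eqxx.
    by rewrite take_cat_rcons nf mul0r.
  have lt_i : (0 < i < n.+1)%N by move: lt_in; rewrite lt0n i0 (negbTE ne_in).
  case: (contractE lt_i) => [Ei|Ei|[p [q mE]]]; last by rewrite mE nf.
    by rewrite Ei eqxx in ij.
  by rewrite Ei eqxx in ij'.
rewrite (bigD1 (Ordinal lt_j)) //= (bigD1 (Ordinal lt_j')) /=; last first.
  by rewrite -val_eqE /= gtn_eqF.
rewrite F1 F2 exprS mulN1r scaleNr addrA subrr add0r big1 // => i /andP[ne1 ne2].
by rewrite F3 ?scaler0.
Qed.

Lemma size_contract i s : (0 < i < size s)%N -> size (contract i s) = (size s).-1.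
Proof.
case: i => // i /= lt_i; rewrite /contract size_cat /= size_drop size_take /=.
rewrite (ltnW lt_i) -subSn // subSS; apply/succn_inj.
by rewrite -addSn subnKC ?prednK // (leq_ltn_trans _ lt_i) // ltnW.
Qed.

Lemma hochschild_CHpred f : f \in CHpred -> hochschild f \in CHpred.
Proof.
move=> /CHpredP[mf nf [N hN]]; apply/CHpredP; split.
- by move=> c x y s1 s2; move: c x y; exact: hochschild_slot.
- by move=> s1 s2; exact: hochschild1.
exists N.+1 => -[|a s] // Ns; rewrite /hochschild /= hN // mulr0 add0r.
rewrite big_nat big1 => [|i /andP[i_gt0 lt_i]]; last first.
  by rewrite hN ?scaler0 // size_contract ?i_gt0.
rewrite hN ?mul0r ?scaler0 ?addr0 // size_take /=.
by rewrite ltnS leqnn.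
Qed.

Lemma cupf_CHpred f g :
  f \in CHpred -> g \in CHpred -> cupf f g \in CHpred.
Proof.
move=> /CHpredP[mf nf [N hN]] /CHpredP[mg ng [M hM]].
have splitE s1 s2 i : (exists p, forall x, take i (s1 ++ x :: s2) = take i s1
      /\ drop i (s1 ++ x :: s2) = p ++ x :: s2) \/
    (exists q, forall x, take i (s1 ++ x :: s2) = s1 ++ x :: q
      /\ drop i (s1 ++ x :: s2) = drop (i - (size s1).+1) s2).
  case: (ltngtP i (size s1)) => [lt_i|lt_i|->].
  - by left; exists (drop i s1) => x; rewrite take_cat drop_cat lt_i.
  - right; exists (take (i - (size s1).+1) s2) => x.
    by rewrite take_cat drop_cat ltnNge (ltnW lt_i) /= -subSS subSn.
  - by left; exists [::] => x; rewrite take_size_cat ?drop_size_cat ?take_size.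
apply/CHpredP; split.
- move=> c x y s1 s2; move: c x y.
  change (slot (fun x => cupf f g (s1 ++ x :: s2))).
  rewrite (_ : (fun x => _) = fun x => \sum_(i < (size s1 + size s2).+2)
      f (take i (s1 ++ x :: s2)) * g (drop i (s1 ++ x :: s2))); last first.
    by apply/funext => x; rewrite /cupf size_cat /= addnS.
  apply: slot_sum => i _.
  have [[p E]|[q E]] := splitE s1 s2 i => c x y.
    rewrite !(proj1 (E _)) !(proj2 (E _)); move: c x y.
    exact/slotMl/slotf.
  rewrite !(proj1 (E _)) !(proj2 (E _)); move: c x y.
  exact/slotMr/slotf.
- move=> s1 s2; rewrite /cupf big1 // => i _.
  have [[p E]|[q E]] := splitE s1 s2 i; have [-> ->] := E 1.
    by rewrite ng mulr0.
  by rewrite nf mul0r.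
- exists (N + M)%N => s le_s; rewrite /cupf big1 // => i _.
  case: (leqP N i) => [le_i|lt_i].
    by rewrite hN ?mul0r // size_takel // -ltnS.
  have le_M : (M <= size s - i)%N.
    by rewrite -[X in (X <= _)%N](addKn N M) leq_sub // ltnW.
  by rewrite hM ?mulr0 // size_drop.
Qed.

Lemma lin_funE (W : vectType k) (u : A -> W) :
  (forall c x y, u (c *: x + y) = c *: u x + u y) -> forall x, linfun u x = u x.
Proof.
move=> lu x.
pose U : {linear A -> W} := HB.pack u (GRing.isLinear.Build _ _ _ _ u lu).
exact: (lfunE U).
Qed.

Lemma BVf_lin (eta : {symmetric A}) f s : multilinear f ->
  forall c x y, (eta 1 (cyclic_norm f ((c *: x + y) :: s)) : k^o) =
    c *: (eta 1 (cyclic_norm f (x :: s)) : k^o)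
    + eta 1 (cyclic_norm f (y :: s)).
Proof.
by move=> mf c x y; rewrite (cyclic_norm_slot [::] s mf c x y) linearPr.
Qed.

Lemma eta_flatE (eta : {symmetric A}) a b : eta_flat eta b a = eta a b.
Proof.
have E b' a' : linfun (fun a => eta a b' : k^o) a' = eta a' b'.
  by rewrite lin_funE // => c x y; rewrite linearPl.
rewrite /eta_flat lin_funE ?E // => c x y; apply/lfunP => a'.
by rewrite add_lfunE scale_lfunE !E linearPr.
Qed.

Lemma BVf_CHpred eta f : f \in CHpred -> BVf eta f \in CHpred.
Proof.
move=> /CHpredP[mf nf [N hN]].
have linE := lin_funE; have L := BVf_lin eta _ mf.
apply/CHpredP; split.
- move=> c x y s1 s2; rewrite /BVf -linearP; congr (_ _).
  apply/lfunP => a0; rewrite add_lfunE scale_lfunE !linE //.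
  rewrite -!cat_cons (cyclic_norm_slot (a0 :: s1) s2 mf c x y).
  by rewrite linearPr.
- move=> s1 s2; rewrite /BVf (_ : linfun _ = 0) ?linear0 //.
  apply/lfunP => a0; rewrite linE // zero_lfunE cyclic_norm1 ?linear0r //.
  by rewrite inE mem_cat mem_head !orbT.
- exists N => s Ns; rewrite /BVf (_ : linfun _ = 0) ?linear0 //.
  apply/lfunP => a0; rewrite linE // zero_lfunE /cyclic_norm big1 ?linear0r //.
  by move=> i _; rewrite hN ?scaler0 // size_rotr leqW.
Qed.

Definition CHdiff (f : CHbar) : CHbar :=
  CHbar_of (hochschild_CHpred (valP f)).

Definition CHcup (f g : CHbar) : CHbar :=
  CHbar_of (cupf_CHpred (valP f) (valP g)).

Definition CHDelta (eta : {symmetric A}) (f : CHbar) : CHbar :=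
  CHbar_of (BVf_CHpred eta (valP f)).

Lemma CHDeltaE (eta : {symmetric A}) (f : CHbar) a0 s : nondegenerate eta ->
  eta a0 (CHDelta eta f s) = eta 1 (cyclic_norm f (a0 :: s)).
Proof.
move=> /eqP rad0; have /CHpredP[mf _ _] := valP f.
have ker0 : lker (eta_flat eta) = 0%VS.
  apply/eqP; rewrite -subv0 -rad0; apply/subvP => b.
  rewrite memv_ker => /eqP b0; apply/mem_orthovP => a _.
  by apply/eqP; rewrite herm_eq0C -eta_flatE b0 zero_lfunE.
have img : limg (eta_flat eta) = fullv.
  apply/eqP; rewrite eqEdim subvf limg_dim_eq ?ker0 ?capv0 //.
  by rewrite !dimvf /dim /= muln1.
rewrite /= /BVf -eta_flatE limg_lfunVK ?img ?memvf //.
by rewrite lin_funE //; exact: BVf_lin.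
Qed.

End Cochains.

(* Main.v *)
(* The homotopy for the graded commutativity of the cup product is the Gerstenhaber
   product f o g.  The Gerstenhaber bracket {f, g} is a strict derivation of the cup
   product in one argument (for the product o) and, by means of the brace f{g, h}, a
   derivation up to homotopy in the other one.  Through eta a cochain f becomes the
   functional eta(a_0, f(a_1, ...)) on cyclic words, and Delta(f g)(a_0, a_1, ...)
   is a sum over cyclic words in which a_0 is an argument of f or an argument of g.
   Inserting g into f on one side of a_0 only gives a homotopy from the first half
   to g Delta(f), up to f o g; the second half is symmetric.  So Delta(f g) is
   homotopic to f Delta(g) + g Delta(f) + {f, g} up to signs, and the seven-term
   relation follows from the Leibniz rule of the bracket.  Delta^2 vanishes strictly,
   since it inserts the unit into f. *)

Require Import Defs.
From mathcomp Require Import all_boot all_order all_algebra all_field.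
From mathcomp Require Import boolp zify.

Set Implicit Arguments.
Unset Strict Implicit.
Unset Printing Implicit Defensive.

Import GRing.Theory.

Local Open Scope ring_scope.

(** The obstacle is the signs, which depend on degrees modulo 2 and on the place of an insertion.
    They are booleans acting on an abelian group through [sg], and the operations are indexed by
    parities instead of degrees. Once the parities are fixed, an identity between cochains is a
    formal identity in an abelian group, which [abel] decides by computation. The Hochschild
    differential is cut into its inner terms [dmid] and its outer terms [dleft] and [dright]. The
    inner terms make sense for functions on words with values in any module, in particular for the
    scalar functionals on cyclic words; the outer ones need values in the algebra and produce the
    cup products in the formula for the differential of [f o g]. Operations act on arbitrary
    functions [Phi] on words, not on cochains only: fixing a first letter turns [Phi] into
    [fun t => Phi (x :: t)], so that definitions and proofs can go by recursion on the word.
    Multilinearity, normalization and finiteness are carried along separately. *)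

Inductive zexp := ZVar of nat | ZZero | ZOpp of zexp | ZAdd of zexp & zexp.

Fixpoint zeval (W : zmodType) (env : seq W) e : W :=
  match e with
  | ZVar n => env`_n
  | ZZero => 0
  | ZOpp e1 => - zeval env e1
  | ZAdd e1 e2 => zeval env e1 + zeval env e2
  end.

(** Starting from [neg = false] counts the positive occurrences of a variable, from [neg = true] the
    negative ones. [zevalP] compares them crosswise to avoid subtraction of natural numbers. *)
Fixpoint zcount e (neg : bool) (i : nat) : nat :=
  match e with
  | ZVar n => if neg then 0%N else n == i
  | ZZero => 0%N
  | ZOpp e1 => zcount e1 (~~ neg) i
  | ZAdd e1 e2 => (zcount e1 neg i + zcount e2 neg i)%N
  end.

Lemma zevalE (W : zmodType) (env : seq W) e : zeval env e =
  \sum_(i < size env) (env`_i *+ zcount e false i - env`_i *+ zcount e true i).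
Proof.
elim: e => [n||e IH|e1 IH1 e2 IH2] /=.
- case: (ltnP n (size env)) => [lt_n|le_n]; last first.
    rewrite nth_default // big1 // => i _.
    by rewrite gtn_eqF ?subrr // (leq_trans (ltn_ord i)).
  rewrite (bigD1 (Ordinal lt_n)) //= eqxx subr0 big1 ?addr0 // => i ne_i.
  by rewrite eq_sym (negbTE ne_i : (i == n :> nat) = false) subrr.
- by rewrite big1 // => i _; rewrite subrr.
- by rewrite IH -sumrN; apply: eq_bigr => i _; rewrite opprB.
- rewrite IH1 IH2 -big_split; apply: eq_bigr => i _.
  by rewrite !mulrnDr opprD addrACA.
Qed.

Lemma zevalP (W : zmodType) (env : seq W) e1 e2 :
  all (fun i => zcount e1 false i + zcount e2 true i ==
                zcount e2 false i + zcount e1 true i)%N (iota 0 (size env)) ->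
  zeval env e1 = zeval env e2.
Proof.
move=> /allP E; rewrite !zevalE; apply: eq_bigr => i _; apply/eqP.
have /E/eqP Ei : val i \in iota 0 (size env) by rewrite mem_iota /= ltn_ord.
by rewrite subr_eq addrAC eq_sym subr_eq -!mulrnDr Ei.
Qed.

Ltac zindex eqt x l :=
  lazymatch l with
  | ?y :: ?l' =>
    match constr:(tt) with
    | _ => let e := eqt x y in constr:(0%N)
    | _ => let n := zindex eqt x l' in constr:(S n)
    end
  end.

Ltac zatoms eqt e l :=
  lazymatch e with
  | (?a + ?b)%R => let l1 := zatoms eqt a l in zatoms eqt b l1
  | (- ?a)%R => zatoms eqt a l
  | 0%R => l
  | _ => match constr:(tt) with
         | _ => let n := zindex eqt e l in l
         | _ => constr:(e :: l)
         end
  end.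

Ltac zreify eqt e l :=
  lazymatch e with
  | (?a + ?b)%R =>
    let a' := zreify eqt a l in let b' := zreify eqt b l in constr:(ZAdd a' b')
  | (- ?a)%R => let a' := zreify eqt a l in constr:(ZOpp a')
  | 0%R => constr:(ZZero)
  | _ => let n := zindex eqt e l in constr:(ZVar n)
  end.

(* Atoms are compared syntactically first, then up to conversion: the same term
   may be typed through different canonical instances. *)
Ltac zsyntactic x y := lazymatch x with y => constr:(tt) end.
Ltac zconvertible x y := constr:(erefl x : x = y).

Ltac abel_with eqt :=
  lazymatch goal with
  | |- @eq ?W ?x ?y =>
    let l := zatoms eqt x (@nil W) in
    let l := zatoms eqt y l in
    let ex := zreify eqt x l in
    let ey := zreify eqt y l in
    exact: (@zevalP _ l ex ey isT)
  end.

Ltac abel := first [abel_with zsyntactic | abel_with zconvertible].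

(** * Signs as booleans *)

Section Signs.
Variable W : zmodType.
Implicit Types (x y : W) (b : bool).

Definition sg b x : W := if b then - x else x.

Lemma sg0 b : sg b 0 = 0. Proof. by case: b; rewrite /= ?oppr0. Qed.
Lemma sgD b x y : sg b (x + y) = sg b x + sg b y.
Proof. by case: b; rewrite //= opprD. Qed.
Lemma sgN b x : sg b (- x) = - sg b x. Proof. by case: b. Qed.
Lemma sgB b x y : sg b (x - y) = sg b x - sg b y.
Proof. by rewrite sgD sgN. Qed.
Lemma sgA b1 b2 x : sg b1 (sg b2 x) = sg (b1 (+) b2) x.
Proof. by case: b1 b2 => -[]; rewrite //= opprK. Qed.
Lemma sgNb b x : sg (~~ b) x = - sg b x.
Proof. by case: b; rewrite //= opprK. Qed.

End Signs.

Section Morph.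
Variables (W W' : zmodType) (h : W -> W').
Hypothesis hD : {morph h : x y / x + y}.

Lemma morph0 : h 0 = 0.
Proof. by apply: (addrI (h 0)); rewrite -hD !addr0. Qed.

Lemma morph_sg b x : h (sg b x) = sg b (h x).
Proof. by case: b => //=; apply/eqP; rewrite -addr_eq0 -hD addNr morph0. Qed.

End Morph.

Lemma sgZ (k : pzRingType) (W : lmodType k) b c (x : W) :
  sg b (c *: x) = c *: sg b x.
Proof. by case: b; rewrite //= scalerN. Qed.

Lemma sg_odd (k : pzRingType) (W : lmodType k) n (x : W) :
  (-1) ^+ n *: x = sg (odd n) x.
Proof. by rewrite -signr_odd; case: odd; rewrite ?expr1 ?scaleN1r ?scale1r. Qed.

(** * Sums over the splittings of a word *)

Section SplitSums.
Variable T : Type.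
Implicit Types (s u v w : seq T) (x y : T).

Section Additive.
Variable W : zmodType.

(** Both parts of a splitting may be empty. The first letter is moved into [F], so inductions have
    to generalize [F]. *)
Fixpoint ssum (F : seq T -> seq T -> W) s : W :=
  F [::] s + if s is x :: s' then ssum (fun u v => F (x :: u) v) s' else 0.

Definition on_head (G : T -> seq T -> W) s : W :=
  if s is x :: s' then G x s' else 0.

Definition on_last (G : seq T -> T -> W) s : W :=
  if s is x :: s' then G (belast x s') (last x s') else 0.

Fixpoint msum (G : seq T -> T -> seq T -> W) s : W :=
  if s is x :: s' then G [::] x s' + msum (fun u => G (x :: u)) s' else 0.

Lemma ssum_cons F x s :
  ssum F (x :: s) = F [::] (x :: s) + ssum (fun u v => F (x :: u) v) s.
Proof. by []. Qed.

Lemma on_last_rcons G s x : on_last G (rcons s x) = G s x.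
Proof.
by case: s => [|y s] //=; rewrite belast_rcons last_rcons.
Qed.

Lemma on_headE G G' s : (forall x s', s = x :: s' -> G x s' = G' x s') ->
  on_head G s = on_head G' s.
Proof. by case: s => //= x s ->. Qed.

Lemma on_lastE G G' s : (forall s' x, s = rcons s' x -> G s' x = G' s' x) ->
  on_last G s = on_last G' s.
Proof. by case/lastP: s => // s x E; rewrite !on_last_rcons E. Qed.

Lemma on_headD G G' s :
  on_head (fun x s' => G x s' + G' x s') s = on_head G s + on_head G' s.
Proof. by case: s => //=; rewrite addr0. Qed.

Lemma on_lastD G G' s :
  on_last (fun s' x => G s' x + G' s' x) s = on_last G s + on_last G' s.
Proof. by case: s => //=; rewrite addr0. Qed.

Lemma on_head_sg b G s : on_head (fun x s' => sg b (G x s')) s = sg b (on_head G s).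
Proof. by case: s => //=; rewrite sg0. Qed.

Lemma on_last_sg b G s : on_last (fun s' x => sg b (G s' x)) s = sg b (on_last G s).
Proof. by case: s => //=; rewrite sg0. Qed.

Lemma eq_ssum F G s : (forall u v, s = u ++ v -> F u v = G u v) ->
  ssum F s = ssum G s.
Proof.
elim: s F G => [|x s IH] F G E /=; first by rewrite E.
by rewrite E //; congr (_ + _); apply: IH => u v Es; rewrite E //= Es.
Qed.

Lemma ssum0 F s : (forall u v, s = u ++ v -> F u v = 0) -> ssum F s = 0.
Proof.
elim: s F => [|x s IH] F E /=; first by rewrite E // addr0.
by rewrite E // IH ?addr0 // => u v Es; rewrite E //= Es.
Qed.

Lemma ssum_neq0 F s : ssum F s != 0 -> exists u v, s = u ++ v /\ F u v != 0.
Proof.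
elim: s F => [|x s IH] F; first by rewrite /= addr0 => E; exists [::], [::].
rewrite ssum_cons; have [->|F0 _] := eqVneq (F [::] (x :: s)) 0; last first.
  by exists [::], (x :: s).
by rewrite add0r => /IH [u [v [-> Fuv]]]; exists (x :: u), v.
Qed.

Lemma ssumD F G s : ssum (fun u v => F u v + G u v) s = ssum F s + ssum G s.
Proof.
elim: s F G => [|x s IH] F G /=; first by rewrite !addr0.
by rewrite IH addrACA.
Qed.

Lemma ssum_sg b F s : ssum (fun u v => sg b (F u v)) s = sg b (ssum F s).
Proof.
elim: s F => [|x s IH] F /=; first by rewrite !addr0.
by rewrite IH sgD.
Qed.

Lemma ssumN F s : ssum (fun u v => - F u v) s = - ssum F s.
Proof. exact: (ssum_sg true). Qed.

Lemma ssum_rcons F s x :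
  ssum F (rcons s x) = ssum (fun u v => F u (rcons v x)) s + F (rcons s x) [::].
Proof.
elim: s F => [|y s IH] F /=; first by rewrite !addr0.
by rewrite IH addrA.
Qed.

(** Coassociativity of deconcatenation: either order of cutting runs over all ways to write [s] as
    three consecutive words. *)
Lemma ssum_assoc (F : seq T -> seq T -> seq T -> W) s :
  ssum (fun u v => ssum (F u) v) s =
  ssum (fun t w => ssum (fun u v => F u v w) t) s.
Proof.
elim: s F => [|x s IH] F /=; first by rewrite !addr0.
by rewrite IH !ssumD addr0 addrA.
Qed.

Lemma ssum_cat_mid F s1 x s2 : ssum F (s1 ++ x :: s2) =
  ssum (fun u v => F u (v ++ x :: s2)) s1 + ssum (fun u v => F (s1 ++ x :: u) v) s2.
Proof.
elim: s1 F => [|y s1 IH] F /=; first by rewrite addr0.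
by rewrite IH addrA.
Qed.

(** Together with [ssum_last_l] this moves a letter across a cut: it can be counted as the first
    letter on the right or as the last one on the left. Terms at the boundary of two neighbouring
    blocks are matched in this way. *)
Lemma ssum_head_r G s :
  ssum (fun u v => on_head (fun y v' => G u y v') v) s = msum G s.
Proof. by elim: s G => [|x s IH] G /=; rewrite ?addr0 ?IH. Qed.

Lemma ssum_nil_r (F : seq T -> W) (G : seq T -> T -> seq T -> W) s :
  ssum (fun u v => if v is x :: v' then G u x v' else F u) s = F s + msum G s.
Proof.
elim: s F G => [|x s IH] F G /=; first by [].
by rewrite IH; abel.
Qed.

Lemma ssum_nil_l (F : seq T -> W) s :
  ssum (fun u v => if u is [::] then F v else 0) s = F s.
Proof. by case: s => [|x s] /=; rewrite ?addr0 // ssum0 ?addr0. Qed.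

Lemma ssum_last_l G s :
  ssum (fun u v => on_last (fun u' y => G u' y v) u) s = msum G s.
Proof.
elim: s G => [|x s IH] G /=; first by rewrite addr0.
rewrite add0r -IH; case: s {IH} => [|y s] /=; first by rewrite !addr0.
by rewrite add0r.
Qed.

Lemma ssum_head_l (G : T -> seq T -> seq T -> W) s :
  ssum (fun u v => on_head (fun y u' => G y u' v) u) s =
  on_head (fun y s' => ssum (G y) s') s.
Proof. by case: s => [|x s] /=; rewrite ?addr0 ?add0r. Qed.

Lemma ssum_last_r (G : seq T -> seq T -> T -> W) s :
  ssum (fun u v => on_last (fun v' y => G u v' y) v) s =
  on_last (fun s' y => ssum (fun u v' => G u v' y) s') s.
Proof.
case/lastP: s => [|s x]; first by rewrite /= addr0.
rewrite ssum_rcons on_last_rcons /= addr0.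
by apply: eq_ssum => u v _; rewrite on_last_rcons.
Qed.

End Additive.

Section Morph.
Variables (W W' : zmodType) (h : W -> W').
Hypothesis hD : {morph h : x y / x + y}.

Lemma morph_ssum F s : h (ssum F s) = ssum (fun u v => h (F u v)) s.
Proof.
by elim: s F => [|x s IH] F /=; rewrite hD ?IH ?(morph0 hD).
Qed.

Lemma morph_on_last G s : h (on_last G s) = on_last (fun u x => h (G u x)) s.
Proof. by case: s => //=; rewrite (morph0 hD). Qed.

Lemma morph_on_head G s : h (on_head G s) = on_head (fun x v => h (G x v)) s.
Proof. by case: s => //=; rewrite (morph0 hD). Qed.

End Morph.

End SplitSums.

(** * Multilinear functions on words and the inner Hochschild terms *)

Section Slots.
Variables (k : fieldType) (A : falgType k).
Implicit Types (s t u v w : seq A) (x y : A) (c b : bool) (a : k).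

Section Target.
Variable W : lmodType k.
Implicit Types (Phi Psi : seq A -> W).

Definition mlinear Phi : Prop := forall a x y s1 s2,
  Phi (s1 ++ (a *: x + y) :: s2) = a *: Phi (s1 ++ x :: s2) + Phi (s1 ++ y :: s2).

Definition vanish1 Phi : Prop := forall s1 s2, Phi (s1 ++ 1 :: s2) = 0.

(** One notion for three uses: the parity of a cochain, its exact degree, and a bound on the lengths
    at which it is nonzero. The zero function has every parity and every degree. *)
Definition supported (D : nat -> Prop) Phi : Prop := forall s, Phi s != 0 -> D (size s).

Definition parity b := supported (fun n => odd n = b).

Lemma mlinear_morph Phi s1 s2 : mlinear Phi ->
  {morph (fun x => Phi (s1 ++ x :: s2)) : x y / x + y}.
Proof. by move=> mP x y; have := mP 1 x y s1 s2; rewrite !scale1r. Qed.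

Lemma mlinear_cons Phi x : mlinear Phi -> mlinear (fun t => Phi (x :: t)).
Proof. by move=> mP a y z p q; exact: (mP a y z (x :: p) q). Qed.

Lemma vanish1_cons Phi x : vanish1 Phi -> vanish1 (fun t => Phi (x :: t)).
Proof. by move=> nP p q; exact: (nP (x :: p) q). Qed.

(* The inner terms of the Hochschild differential, the product of the letters
   number [i] and [i + 1] (counted from 1) carrying the sign [(-1)^i]. *)
Fixpoint dmid Phi s : W :=
  if s is x :: s' then
    - (if s' is y :: s'' then Phi (x * y :: s'') else 0) - dmid (fun t => Phi (x :: t)) s'
  else 0.

Lemma dmid_cons Phi x s : dmid Phi (x :: s) =
  - on_head (fun y s' => Phi (x * y :: s')) s - dmid (fun t => Phi (x :: t)) s.
Proof. by []. Qed.

Lemma dmidD Phi Psi s : dmid (fun t => Phi t + Psi t) s = dmid Phi s + dmid Psi s.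
Proof.
elim: s Phi Psi => [|x s IH] Phi Psi; first by rewrite /= addr0.
by rewrite !dmid_cons IH on_headD !opprD addrACA.
Qed.

Lemma dmid0 s : dmid (fun _ => 0) s = 0.
Proof. by elim: s => [|x s IH] //; rewrite dmid_cons IH subr0; case: (s) => *;
  rewrite /= oppr0. Qed.

Lemma dmid_sg b Phi s : dmid (fun t => sg b (Phi t)) s = sg b (dmid Phi s).
Proof.
elim: s Phi => [|x s IH] Phi; first by rewrite /= sg0.
by rewrite !dmid_cons IH on_head_sg sgB sgN.
Qed.

(** [dmid] evaluates its argument on words that are one letter shorter, hence the negation. *)
Lemma dmid_sg_odd c Phi s :
  dmid (fun t => sg (odd (size t) && c) (Phi t)) s = sg (~~ odd (size s) && c) (dmid Phi s).
Proof.
(* A letter put in front flips the parity of the remaining length, so the induction needs the offset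
   [d]. *)
have aux d : dmid (fun t => sg ((d (+) odd (size t)) && c) (Phi t)) s =
    sg ((d (+) ~~ odd (size s)) && c) (dmid Phi s).
  elim: s Phi d => [|x s IH] Phi d; first by rewrite /= sg0.
  rewrite !dmid_cons /= (_ : (fun t => sg _ _) =
    fun t => sg (((~~ d) (+) odd (size t)) && c) (Phi (x :: t))); last first.
    by apply/funext=> t; rewrite addNb addbN.
  rewrite IH addNb addbN negbK sgB sgN; congr (- _ - _); last by rewrite negbK.
  by case: s {IH} => [|y s] /=; rewrite ?sg0 //; case: odd; case: d.
exact: (aux false).
Qed.

(** When a word is cut after two letters have been multiplied, the product lies on one side of the
    cut. So there is no term multiplying letters from different sides. *)
Lemma dmid_ssum (F : seq A -> seq A -> W) s : dmid (ssum F) s =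
  ssum (fun u v => dmid (fun u' => F u' v) u + sg (odd (size u)) (dmid (F u) v)) s.
Proof.
elim: s F => [|x s IH] F; first by rewrite /= !addr0.
rewrite dmid_cons ssum_cons /= add0r.
have -> : on_head (fun y s' => ssum F (x * y :: s')) s =
    on_head (fun y s' => F [::] (x * y :: s')) s +
    ssum (fun u v => on_head (fun y u' => F (x * y :: u') v) u) s.
  by rewrite ssum_head_l -on_headD.
rewrite dmidD IH -/(on_head (fun y s' => F [::] (x * y :: s')) s) !opprD !addrA.
rewrite -!addrA; congr (_ + _); rewrite addrCA; congr (_ + _).
rewrite -!ssumN -ssumD; apply: eq_ssum => u v _.
by rewrite sgNb opprD !addrA.
Qed.

End Target.

Lemma dmid_morph (W W' : lmodType k) (h : W -> W') (Phi : seq A -> W) s :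
  {morph h : x y / x + y} -> dmid (fun t => h (Phi t)) s = h (dmid Phi s).
Proof.
move=> hD; elim: s Phi => [|x s IH] Phi; first by rewrite /= morph0.
rewrite !dmid_cons IH hD !(morph_sg hD true) /=; congr (- _ - _).
by case: s {IH} => //=; rewrite morph0.
Qed.

End Slots.

Arguments dmid : simpl never.

(** * Insertion operations *)

Section Slide.
Variables (k : fieldType) (A : falgType k).
Implicit Types (s t u v w : seq A) (x y : A) (c b : bool) (a : k).

Section Target.
Variable W : lmodType k.
Implicit Types (Phi Psi : seq A -> W) (Q : (seq A -> W) -> seq A -> W).

(* [Q] is applied to every suffix of the word, the skipped letters being put in
   front of the arguments of [Phi]; [c] is the parity of [Q], which changes the
   sign each time it moves past a letter. *)
Fixpoint slide c Q Phi s : W :=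
  Q Phi s + if s is x :: s' then sg c (slide c Q (fun t => Phi (x :: t)) s') else 0.

Lemma slide_cons c Q Phi x s : slide c Q Phi (x :: s) =
  Q Phi (x :: s) + sg c (slide c Q (fun t => Phi (x :: t)) s).
Proof. by []. Qed.

Lemma slide_head c Q Phi s : slide c Q Phi s =
  Q Phi s + on_head (fun x s' => sg c (slide c Q (fun t => Phi (x :: t)) s')) s.
Proof. by case: s. Qed.

Definition linQ Q := forall a Phi Psi s,
  Q (fun t => a *: Phi t + Psi t) s = a *: Q Phi s + Q Psi s.

Lemma linQ0 Q s : linQ Q -> Q (fun=> 0) s = 0.
Proof.
move=> lQ; have := lQ 1 (fun=> 0) (fun=> 0) s.
rewrite scale1r addr0 => /(congr1 (fun z => z - Q (fun=> 0) s)).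
by rewrite scale1r addrK subrr.
Qed.

Lemma linQZ Q a Phi s : linQ Q -> Q (fun t => a *: Phi t) s = a *: Q Phi s.
Proof.
move=> lQ; rewrite -[RHS]addr0 -(linQ0 s lQ) -lQ.
by congr (Q _ _); apply/funext=> t; rewrite addr0.
Qed.

Lemma linQD Q Phi Psi s : linQ Q -> Q (fun t => Phi t + Psi t) s = Q Phi s + Q Psi s.
Proof.
move=> lQ; rewrite -[Q Phi s]scale1r -lQ.
by congr (Q _ _); apply/funext=> t; rewrite scale1r.
Qed.

Lemma linQsg Q b Phi s : linQ Q -> Q (fun t => sg b (Phi t)) s = sg b (Q Phi s).
Proof.
case: b => //= lQ; rewrite -scaleN1r -linQZ //.
by congr (Q _ _); apply/funext=> t; rewrite scaleN1r.
Qed.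

Lemma slide_lin c Q : linQ Q -> linQ (slide c Q).
Proof.
move=> lQ a Phi Psi s; elim: s Phi Psi => [|x s IH] Phi Psi;
  first by rewrite /slide lQ !addr0.
by rewrite !slide_cons IH lQ sgD sgZ scalerDr addrACA.
Qed.

(** Only values on nonempty words matter, as for insertions, whose output is itself a letter. This
    is needed for [dright]: [dright f (x :: t)] agrees with [dright (fun t => f (x :: t)) t] unless
    [t] is empty. *)
Definition extQ Q := forall Phi Psi s,
  (forall x t, Phi (x :: t) = Psi (x :: t)) -> Q Phi s = Q Psi s.

Lemma slide_ext c Q : extQ Q -> extQ (slide c Q).
Proof.
move=> eQ Phi Psi s; elim: s Phi Psi => [|x s IH] Phi Psi E;
  first by rewrite /slide (eQ _ Psi).
by rewrite !slide_cons (eQ _ Psi) //; congr (_ + sg _ _); apply: IH.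
Qed.

Lemma slide_mlinear c Q Phi : linQ Q -> (forall Psi, mlinear Psi -> mlinear (Q Psi)) ->
  mlinear Phi -> mlinear (slide c Q Phi).
Proof.
move=> lQ mQ mP a x y s1 s2; elim: s1 Phi mP => [|z s1 IH] Phi mP.
  rewrite !slide_cons (mQ _ mP a x y [::] s2).
  rewrite (_ : (fun t => Phi (a *: x + y :: t)) =
    fun t => a *: Phi (x :: t) + Phi (y :: t)); last first.
    by apply/funext=> t; exact: (mP a x y [::]).
  by rewrite slide_lin // sgD sgZ scalerDr addrACA.
rewrite !cat_cons !slide_cons (mQ _ mP a x y (z :: s1)) IH; last exact: mlinear_cons.
by rewrite sgD sgZ scalerDr addrACA.
Qed.

Lemma slide_vanish1 c Q Phi : linQ Q -> (forall Psi, mlinear Psi -> vanish1 Psi ->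
  vanish1 (Q Psi)) ->
  mlinear Phi -> vanish1 Phi -> vanish1 (slide c Q Phi).
Proof.
move=> lQ nQ mP nP s1 s2; elim: s1 Phi mP nP => [|z s1 IH] Phi mP nP.
  rewrite slide_cons (nQ _ mP nP [::] s2) add0r.
  rewrite (_ : (fun t => _) = fun=> 0); last by apply/funext=> t; exact: (nP [::]).
  by rewrite linQ0 ?sg0 //; exact: slide_lin.
rewrite !cat_cons slide_cons (nQ _ mP nP (z :: s1)) IH; last exact: vanish1_cons.
  by rewrite sg0 addr0.
exact: mlinear_cons.
Qed.

(** [o] is the number of letters that [Q] produces (one for an insertion, two for a brace), and [E]
    describes the number of letters that it consumes. *)
Lemma slide_supported c Q Phi o (D E F : nat -> Prop) :
  (forall Psi D F, mlinear Psi -> (forall i j, D (i + o)%N -> E j -> F (i + j)%N) ->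
    supported D Psi -> supported F (Q Psi)) ->
  mlinear Phi -> (forall i j, D (i + o)%N -> E j -> F (i + j)%N) ->
  supported D Phi -> supported F (slide c Q Phi).
Proof.
move=> sQ mP DEF sP s; elim: s D F Phi mP DEF sP => [|x s IH] D F Phi mP DEF sP.
  by rewrite /slide addr0; exact: (sQ _ D).
rewrite slide_cons; have [Q0|Q0 _] := eqVneq (Q Phi (x :: s)) 0; last first.
  by apply: (sQ _ D) Q0.
rewrite Q0 add0r => S0; apply: (IH (fun n => D n.+1) (fun n => F n.+1)
  _ (mlinear_cons x mP)).
- by move=> i j Di Ej; rewrite -addSn; apply: DEF.
- by move=> t; exact: sP.
- by apply: contraNneq S0 => ->; rewrite sg0.
Qed.

(** The term subtracted in the hypothesis multiplies a letter [x] with the output of [Q] placed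
    right after it. In [slide c Q (dmid Phi)] this product arises at the position following [x]. So
    the positions do not match one by one, but their sum does. *)
Lemma slide_dmid c Q Q' Phi s : linQ Q ->
  (forall Psi s, mlinear Psi -> dmid (Q Psi) s = sg c (Q (dmid Psi) s) + Q' Psi s
     - on_head (fun x s' => Q (on_head (fun y t => Psi (x * y :: t))) s') s) ->
  mlinear Phi -> dmid (slide c Q Phi) s = sg c (slide c Q (dmid Phi) s) + slide (~~ c)
    Q' Phi s.
Proof.
move=> lQ bQ mP; have lS := slide_lin c lQ.
elim: s Phi mP => [|x s IH] Phi mP.
  by have := bQ Phi [::] mP; rewrite !slide_head /= subr0 !addr0.
have mPx := mlinear_cons x mP.
rewrite (_ : slide c Q Phi = fun s => Q Phi s +
  on_head (fun x s' => sg c (slide c Q (fun t => Phi (x :: t)) s')) s); last first.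
  by apply/funext=> t; exact: slide_head.
rewrite dmidD bQ // [X in _ + X]dmid_cons !slide_cons /= dmid_sg IH //.
have -> : slide c Q (fun t => dmid Phi (x :: t)) s =
    - Q (on_head (fun y t => Phi (x * y :: t))) s
    - on_head (fun y s' => sg c (slide c Q (fun t => Phi (x * y :: t)) s')) s
    - slide c Q (dmid (fun t => Phi (x :: t))) s.
  rewrite (_ : (fun t => _) = fun t => sg true (on_head (fun y t => Phi (x * y :: t)) t)
     + sg true (dmid (fun t => Phi (x :: t)) t)); last by apply/funext.
  by rewrite linQD // !linQsg //= slide_head opprD.
by rewrite !sgD !sgN !sgA addbb !sgNb /=; abel.
Qed.

End Target.
End Slide.

Arguments dmid : simpl never.
Arguments slide : simpl never.

Section Insertion.
Variables (k : fieldType) (A : falgType k).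
Implicit Types (s t u v w : seq A) (c b : bool) (a : k).
Implicit Types (f g h : seq A -> A).

Definition dleft f : seq A -> A := on_head (fun x s => x * f s).
Definition dright f : seq A -> A := on_last (fun s x => f s * x).
Definition hdiff f s : A := dleft f s + dmid f s + sg (odd (size s)) (dright f s).
Definition cup f g s : A := ssum (fun u v => f u * g v) s.

Lemma mulr_morph (x : A) : {morph (fun y => x * y) : y z / y + z}.
Proof. by move=> y z; rewrite mulrDr. Qed.

Lemma mull_morph (x : A) : {morph (fun y => y * x) : y z / y + z}.
Proof. by move=> y z; rewrite mulrDl. Qed.

Lemma parity_sg (W : lmodType k) (Phi : seq A -> W) b s :
  parity b Phi -> sg (odd (size s)) (Phi s) = sg b (Phi s).
Proof.
by move=> pP; have [->|/pP ->//] := eqVneq (Phi s) 0; rewrite !sg0.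
Qed.

Lemma parity_sg_add (W : lmodType k) (Phi : seq A -> W) b d s :
  parity b Phi -> sg (odd (size s) (+) d) (Phi s) = sg (b (+) d) (Phi s).
Proof. by move=> pP; rewrite addbC -sgA (parity_sg _ pP) sgA addbC. Qed.

Lemma dleft_supported (D E : nat -> Prop) f : (forall i, D i -> E i.+1) ->
  supported D f -> supported E (dleft f).
Proof.
move=> DE sf [|x s]; rewrite /dleft /= ?eqxx // => ne; apply/DE/sf.
by apply: contraNneq ne => ->; rewrite mulr0.
Qed.

Lemma dright_supported (D E : nat -> Prop) f : (forall i, D i -> E i.+1) ->
  supported D f -> supported E (dright f).
Proof.
move=> DE sf s; case/lastP: s => [|s x]; rewrite /dright ?eqxx // on_last_rcons.
rewrite size_rcons => ne; apply/DE/sf.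
by apply: contraNneq ne => ->; rewrite mul0r.
Qed.

Lemma dmid_supported (W : lmodType k) (D E : nat -> Prop) (Phi : seq A -> W) :
  (forall i, D i -> E i.+1) -> supported D Phi -> supported E (dmid Phi).
Proof.
move=> DE sP s; elim: s D E DE Phi sP => [|x s IH] D E DE Phi sP; first by rewrite eqxx.
rewrite dmid_cons; have [->|] := eqVneq (on_head (fun y t => Phi (x * y :: t)) s) 0.
  rewrite oppr0 add0r oppr_eq0.
  apply: (IH (fun n => D n.+1) (fun n => E n.+1)) => [i Di|t]; first exact: DE.
  exact: sP.
move=> H _; move: H; case: s {IH} => [|y s] /=; first by rewrite eqxx.
by move/sP/DE.
Qed.

Lemma hdiff_supported (D E : nat -> Prop) f : (forall i, D i -> E i.+1) ->
  supported D f -> supported E (hdiff f).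
Proof.
move=> DE sf s; rewrite /hdiff.
have [l0|/(dleft_supported DE sf)//] := eqVneq (dleft f s) 0.
have [b0|/(dmid_supported DE sf)//] := eqVneq (dmid f s) 0.
have [r0|/(dright_supported DE sf)//] := eqVneq (dright f s) 0.
by rewrite l0 b0 r0 sg0 !addr0 eqxx.
Qed.

Section Ins.
Variables (W : lmodType k).
Implicit Types (Phi : seq A -> W).

Definition ins_front g Phi s : W := ssum (fun w y => Phi (g w :: y)) s.

Lemma ins_front_lin g : linQ (ins_front g).
Proof.
move=> a Phi Psi s; rewrite /ins_front ssumD; congr (_ + _).
by rewrite (morph_ssum (scalerDr a)).
Qed.

Lemma ins_front_ext g : extQ (ins_front g).
Proof. by move=> Phi Psi s E; apply: eq_ssum. Qed.

Lemma ssum_mlinear (F : seq A -> seq A -> W) :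
  (forall v, mlinear (fun u => F u v)) -> (forall u, mlinear (F u)) -> mlinear (ssum F).
Proof.
move=> mF1 mF2 a x y s1 s2; rewrite !ssum_cat_mid scalerDr addrACA.
rewrite !(morph_ssum (scalerDr a)) -!ssumD.
by congr (_ + _); apply: eq_ssum => u v _; rewrite ?mF1 ?mF2.
Qed.

Lemma ssum_vanish1 (F : seq A -> seq A -> W) :
  (forall v, vanish1 (fun u => F u v)) -> (forall u, vanish1 (F u)) -> vanish1 (ssum F).
Proof.
move=> nF1 nF2 s1 s2; rewrite ssum_cat_mid !ssum0 ?addr0 // => u v _.
  exact: (nF1 v).
exact: (nF2 u).
Qed.

Lemma mlinear0 Phi s1 s2 : mlinear Phi -> Phi (s1 ++ 0 :: s2) = 0.
Proof. by move=> mP; exact: (morph0 (mlinear_morph s1 s2 mP)). Qed.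

Lemma ins_front_mlinear g Phi : mlinear g -> mlinear Phi -> mlinear (ins_front g Phi).
Proof.
move=> mg mP; apply: ssum_mlinear => [v a x y s1 s2|u]; last exact: mlinear_cons.
by rewrite mg (mP _ _ _ [::]).
Qed.

Lemma ins_front_vanish1 g Phi : vanish1 g -> mlinear Phi -> vanish1 Phi ->
  vanish1 (ins_front g Phi).
Proof.
move=> ng mP nP; apply: ssum_vanish1 => [v s1 s2|u]; last exact: vanish1_cons.
by rewrite ng (mlinear0 [::] _ mP).
Qed.

Lemma ins_front_supported g (E : nat -> Prop) Phi (D F : nat -> Prop) : supported E g ->
  mlinear Phi -> (forall i j, D (i + 1)%N -> E j -> F (i + j)%N) ->
  supported D Phi -> supported F (ins_front g Phi).
Proof.
move=> sg mP DEF sP s /ssum_neq0 [u [v [-> ne]]]; rewrite size_cat addnC.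
apply: DEF; first by have := sP _ ne; rewrite addn1.
by apply: sg; apply: contraNneq ne => ->; rewrite (mlinear0 [::]).
Qed.

(* The contractions at the two boundaries of the inserted block [g w] give the
   outer terms of [hdiff g], except when the block is at the front of the word. *)
Lemma ins_front_dmid c g Phi s : parity (~~ c) g -> mlinear Phi ->
  dmid (ins_front g Phi) s = sg c (ins_front g (dmid Phi) s) + ins_front (hdiff g) Phi s
     - on_head (fun x s' => ins_front g (on_head (fun y t => Phi (x * y :: t))) s') s.
Proof.
move=> pg mP; have mh y := mlinear_morph [::] y mP.
have -> : on_head (fun x s' => ins_front g (on_head (fun y t => Phi (x * y :: t))) s') s =
    ssum (fun w y => Phi (dleft g w :: y)) s.
  rewrite -ssum_head_l; apply: eq_ssum => w y _; rewrite /dleft.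
  by rewrite (morph_on_head (mh y)).
have E1 : ssum (fun w y => on_head (fun z t => Phi (g w * z :: t)) y) s =
    ssum (fun w y => Phi (dright g w :: y)) s.
  rewrite ssum_head_r -ssum_last_l; apply: eq_ssum => w y _.
  by rewrite /dright (morph_on_last (mh y)).
rewrite dmid_ssum /ins_front -ssum_sg -ssumN -!ssumD.
transitivity (ssum (fun w y => Phi (dmid g w :: y) - sg c (dmid (fun t => Phi (g w ::
  t)) y)) s).
  apply: eq_ssum => w y _; rewrite (dmid_morph _ _ (mh y)); congr (_ + _).
  rewrite -sgNb; have [->|/pg ->//] := eqVneq (g w) 0.
  by rewrite (_ : (fun t => _) = fun=> 0) ?dmid0 ?sg0 //; apply/funext=> t;
    rewrite (mlinear0 [::]).
(* [E1] holds only after summation over the splittings. With this term added to both sides, the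
   remaining identity holds for each splitting. *)
apply: (addIr (sg c (ssum (fun w y => on_head (fun z t => Phi (g w * z :: t)) y) s))).
rewrite {1}E1 -!ssum_sg -!ssumD; apply: eq_ssum => w y _.
rewrite dmid_cons /hdiff !mh (morph_sg (mh y)) sgB sgN.
have -> : sg (odd (size w)) (Phi (dright g w :: y)) = sg c (Phi (dright g w :: y)).
  have [->|r0] := eqVneq (dright g w) 0; first by rewrite (mlinear0 [::]) ?sg0.
  congr (sg _ _); have /dright_supported - /(_ (fun n => odd n = c)) := pg.
  by apply=> // i /= ->; rewrite negbK.
by rewrite /=; abel.
Qed.

End Ins.
Section SlideRho.
Implicit Types (Q R : (seq A -> A) -> seq A -> A).

Lemma slide_dright c Q R f s : linQ Q -> extQ Q ->
  (forall f s, Q (dright f) s = dright (Q f) s + R f s) ->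
  slide c Q (dright f) s = dright (slide c Q f) s + slide c R f s.
Proof.
move=> lQ eQ rQ; elim: s f => [|x s IH] f.
  by rewrite !slide_head /= !addr0 rQ.
rewrite !slide_cons rQ.
rewrite (@slide_ext _ _ _ c Q eQ (fun t => dright f (x :: t)) (dright (fun t => f (x ::
  t))) s) //.
rewrite IH sgD.
have -> : dright (slide c Q f) (x :: s) =
    dright (Q f) (x :: s) + sg c (dright (slide c Q (fun t => f (x :: t))) s).
  case/lastP: s {IH} => [|s y].
    by rewrite /dright /= !slide_head /= addr0 sg0 addr0.
  rewrite /dright -rcons_cons !on_last_rcons slide_cons mulrDl.
  by rewrite (morph_sg (mull_morph y)).
by abel.
Qed.

(** The sign is the one collected by a block of parity [c] that slides past the letters of [u]. *)
Definition signed_cup c f g s : A := ssum (fun u v => sg (c && odd (size u)) (f u * g v)) s.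

Lemma signed_cup_cons c f g x s : signed_cup c f g (x :: s) =
  f [::] * g (x :: s) + sg c (signed_cup c (fun t => f (x :: t)) g s).
Proof.
rewrite /signed_cup ssum_cons /= andbF -ssum_sg; congr (_ + _).
by apply: eq_ssum => u v _; rewrite sgA; case: c; case: odd.
Qed.

Lemma signed_cupE c f g s : slide c (fun f s => f [::] * g s) f s = signed_cup c f g s.
Proof.
elim: s f => [|x s IH] f; first by rewrite slide_head /signed_cup /= andbF.
by rewrite slide_cons signed_cup_cons IH.
Qed.

Lemma signed_cup_parity c b f g s : parity b f ->
  signed_cup c f g s = sg (c && b) (cup f g s).
Proof.
move=> pf; rewrite /cup -ssum_sg; apply: eq_ssum => u v _.
by have [->|/pf ->//] := eqVneq (f u) 0; rewrite mul0r !sg0.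
Qed.

(** If the block takes the whole word, its output becomes the last letter and is split off by
    [dright], which gives the extra product. Otherwise the last letter is untouched. *)
Lemma ins_front_dright g f s : ins_front g (dright f) s = dright (ins_front g f)
  s + f [::] * g s.
Proof.
rewrite [dright _ _](_ : _ = ssum (fun w y =>
    on_last (fun y' z => f (g w :: y') * z) y) s); last first.
  rewrite ssum_last_r /dright; apply: on_lastE => s' x _.
  exact: (morph_ssum (mull_morph x)).
rewrite /ins_front (_ : f [::] * g s = ssum (fun u v =>
  if v is x :: v' then 0 else f [::] * g u) s); last first.
  rewrite ssum_nil_r (_ : msum _ _ = 0) ?addr0 // -ssum_head_r ssum0 //.
  by move=> u [|x v] _.
rewrite -ssumD; apply: eq_ssum => w y _; case/lastP: y => [|y b].
  by rewrite /= add0r.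
rewrite on_last_rcons /dright -rcons_cons on_last_rcons.
by case: y => *; rewrite addr0.
Qed.

End SlideRho.

Section Ins.
Variables (W : lmodType k).
Implicit Types (Phi : seq A -> W) (Q : (seq A -> W) -> seq A -> W).

(* [insert c g f] is the Gerstenhaber product of [f] and [g] when [c] is the
   parity of [|g| - 1], hence the hypotheses [parity (~~ c) g]. *)
Definition insert c g : (seq A -> W) -> seq A -> W := slide c (ins_front g).

Lemma insert_lin c g : linQ (insert c g).
Proof. exact/slide_lin/ins_front_lin. Qed.

Lemma insert_mlinear c g Phi : mlinear g -> mlinear Phi -> mlinear (insert c g Phi).
Proof.
by move=> mg; apply: slide_mlinear; [exact: ins_front_lin | move=> Psi;
  exact: ins_front_mlinear].
Qed.

Lemma insert_vanish1 c g Phi : vanish1 g -> mlinear Phi -> vanish1 Phi ->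
  vanish1 (insert c g Phi).
Proof.
move=> ng; apply: slide_vanish1; [exact: ins_front_lin | move=> Psi;
  exact: ins_front_vanish1].
Qed.

Lemma insert_supported c g (E D F : nat -> Prop) Phi : supported E g -> mlinear Phi ->
  (forall i j, D (i + 1)%N -> E j -> F (i + j)%N) ->
  supported D Phi -> supported F (insert c g Phi).
Proof.
move=> sg mP; apply: slide_supported => // Psi D' F' mPsi.
exact: ins_front_supported.
Qed.

Lemma insert_dmid c g Phi s : parity (~~ c) g -> mlinear Phi ->
  dmid (insert c g Phi) s = sg c (insert c g (dmid Phi) s) + insert (~~ c) (hdiff g) Phi s.
Proof.
move=> pg mP; apply: slide_dmid => // [|Psi t mPsi]; first exact: ins_front_lin.
exact: ins_front_dmid.
Qed.

Lemma slide_size_sg c Q Phi s : linQ Q ->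
  (forall Psi s, mlinear Psi -> 
     Q (fun t => sg (odd (size t)) (Psi t)) s = sg (odd (size s) (+) c) (Q Psi s)) ->
  mlinear Phi -> slide c Q (fun t => sg (odd (size t)) (Phi t)) s =
    sg (odd (size s) (+) c) (slide c Q Phi s).
Proof.
move=> lQ pQ; elim: s Phi => [|x s IH] Phi mP; rewrite !slide_head /= ?addr0 ?pQ //.
rewrite sgD; congr (_ + _).
rewrite (_ : (fun t => _) = fun t => sg true (sg (odd (size t)) (Phi (x :: t))));
  last first.
  by apply/funext=> t; rewrite sgNb.
rewrite linQsg; last exact: slide_lin.
by rewrite IH; [rewrite !sgA; congr sg; case: odd; case: (c) | exact: mlinear_cons].
Qed.

Lemma ins_front_size_sg c g Phi s : parity (~~ c) g -> mlinear Phi ->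
  ins_front g (fun t => sg (odd (size t)) (Phi t)) s = sg (odd (size s) (+) c)
    (ins_front g Phi s).
Proof.
move=> pg mP; rewrite /ins_front -ssum_sg; apply: eq_ssum => u v -> /=.
have [->|/pg] := eqVneq (g u) 0; first by rewrite (mlinear0 [::] _ mP) !sg0.
by rewrite size_cat oddD => ->; congr sg; case: odd; case: (c).
Qed.

Lemma insert_size_sg c g Phi s : parity (~~ c) g -> mlinear Phi ->
  insert c g (fun t => sg (odd (size t)) (Phi t)) s =
  sg (odd (size s) (+) c) (insert c g Phi s).
Proof.
move=> pg mP; apply: slide_size_sg => // [|Psi t mPsi]; first exact: ins_front_lin.
exact: ins_front_size_sg.
Qed.

Lemma insert_ssum c h (F : seq A -> seq A -> W) s : insert c h (ssum F) s =
  ssum (fun u v => insert c h (fun t => F t v) u +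
                   sg (c && odd (size u)) (insert c h (F u) v)) s.
Proof.
have lI := insert_lin c h.
elim: s F => [|x s IH] F.
  by rewrite /= andbF /insert !slide_head /ins_front /= !addr0 addrC.
rewrite ssum_cons /= andbF /= {1}/insert slide_cons -/(insert c h).
have -> : insert c h (fun t => ssum F (x :: t)) s =
    insert c h (fun t => F [::] (x :: t)) s +
    insert c h (ssum (fun u v => F (x :: u) v)) s by rewrite -linQD.
have -> : ins_front h (ssum F) (x :: s) = ins_front h (F [::]) (x :: s) +
    ssum (fun u v => ins_front h (fun t => F t v) u) (x :: s).
  rewrite /ins_front -(ssum_assoc (fun w u v => F (h w :: u) v)) -ssumD.
  exact: eq_ssum.
rewrite IH ssum_cons sgD -ssum_sg.
rewrite [insert c h (F [::]) _]slide_cons -/(insert c h).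
rewrite [insert c h (fun t => F t (x :: s)) _]slide_head /= addr0.
rewrite [X in _ = _ + X](_ : _ = ssum (fun u v => ins_front h (fun t => F t v) (x :: u)) s +
  ssum (fun u v => sg c (insert c h (fun t => F (x :: t) v) u +
     sg (c && odd (size u)) (insert c h (F (x :: u)) v))) s); first by abel.
rewrite -ssumD; apply: eq_ssum => u v _.
rewrite [insert c h (fun t => F t v) _]slide_cons -/(insert c h) sgD sgA -addrA.
by congr (_ + (_ + sg _ _)); case: (c); case: odd.
Qed.

End Ins.

Lemma insert_morph (W W' : lmodType k) (h : W -> W') c g (Phi : seq A -> W) s :
  {morph h : x y / x + y} ->
  insert c g (fun t => h (Phi t)) s = h (insert c g Phi s).
Proof.
move=> hD; elim: s Phi => [|x s IH] Phi; rewrite /insert !slide_head /= hD ?(morph0 hD).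
  by rewrite /ins_front (morph_ssum hD).
rewrite -[slide c (ins_front g) _ s]/(insert c g (fun t => h (Phi (x :: t))) s).
by rewrite IH (morph_sg hD) /ins_front (morph_ssum hD).
Qed.

Lemma insert_dright c g f s : insert c g (dright f) s = dright (insert c g f)
  s + signed_cup c f g s.
Proof.
rewrite -signed_cupE; apply: slide_dright;
  [exact: ins_front_lin | exact: ins_front_ext | exact: ins_front_dright].
Qed.

Lemma insert_dleft c g f s :
  insert c g (dleft f) s = cup g f s + sg c (dleft (insert c g f) s).
Proof.
rewrite /insert slide_head; congr (_ + _); rewrite on_head_sg; congr sg.
by apply: on_headE => x s' _; exact: (insert_morph c g f s' (mulr_morph x)).
Qed.

Lemma cup_supported (D E F : nat -> Prop) f g :
  (forall i j, D i -> E j -> F (i + j)%N) -> supported D f -> supported E g ->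
    supported F (cup f g).
Proof.
move=> DEF sf sg s /ssum_neq0 [u [v [-> ne]]]; rewrite size_cat.
by apply: DEF; [apply: sf | apply: sg]; apply: contraNneq ne => ->; rewrite ?mulr0 ?mul0r.
Qed.

Lemma cup_parity b b' f g : parity b f -> parity b' g -> parity (b (+) b') (cup f g).
Proof. by apply: cup_supported => i j <- <-; rewrite oddD. Qed.

Lemma insert_parity c b g f : mlinear f -> parity (~~ c) g -> parity b f ->
  parity (b (+) c) (insert c g f).
Proof.
move=> mf pg; apply: (insert_supported pg) => // i j; rewrite !oddD => <- ->.
by case: odd; case: (c).
Qed.

Lemma dright_mlinear f : mlinear f -> mlinear (dright f).
Proof.
move=> mf a x y s1 s2; case/lastP: s2 => [|s2 z].
  by rewrite !cats1 /dright !on_last_rcons mulrDr scalerAr.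
by rewrite -!rcons_cons -!rcons_cat /dright !on_last_rcons mf mulrDl scalerAl.
Qed.

(** The cup products come from the outer terms of [hdiff f]: the output of [g] is the left factor in
    [dleft f] or the right factor in [dright f]. This is Gerstenhaber's formula, solved for the term
    with [hdiff f]. *)
Lemma insert_hdiff c b g f s : mlinear f -> parity (~~ c) g -> parity b f ->
  insert c g (hdiff f) s =
    sg c (hdiff (insert c g f) s) - sg c (insert (~~ c) (hdiff g) f s)
    + cup g f s - sg (b && ~~ c) (cup f g s).
Proof.
move=> mf pg pf; have lI := @insert_lin A c g.
rewrite [X in insert c g X](_ : _ = fun t => (dleft f t + dmid f t) +
  sg (odd (size t)) (dright f t)); last by apply/funext.
rewrite !(linQD _ _ _ lI) insert_dleft insert_size_sg //; last exact: dright_mlinear.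
rewrite insert_dright (signed_cup_parity _ _ _ pf) /hdiff insert_dmid // !sgD !sgA -addbA.
rewrite (parity_sg_add _ _ (cup_parity pf pg)) addbb (addbC c (odd _)).
have -> : b (+) ~~ c (+) (c (+) c && b) = ~~ (b && ~~ c) by case: (b); case: (c).
by rewrite sgNb /=; abel.
Qed.

End Insertion.

(** * The brace operation and its differential *)

Section Brace.
Variables (k : fieldType) (A : falgType k).
Implicit Types (s t u v w : seq A) (b c e : bool) (a : k).
Implicit Types (f g h : seq A -> A).

Lemma insert_cup c b f g h s : parity b f ->
  insert c h (cup f g) s =
  cup (insert c h f) g s + sg (c && b) (cup f (insert c h g) s).
Proof.
move=> pf; rewrite insert_ssum /cup -ssum_sg -ssumD; apply: eq_ssum => u v _.
rewrite (insert_morph c h (fun t => g t) v (mulr_morph (f u)))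
  (insert_morph c h (fun t => f t) u (mull_morph (g v))).
by congr (_ + _); have [->|/pf ->//] := eqVneq (f u) 0; rewrite mul0r !sg0.
Qed.

Section Ins.
Variables (W : lmodType k).
Implicit Types (Phi : seq A -> W) (Q : (seq A -> W) -> seq A -> W).

Definition ins2_front g e h Phi s : W :=
  ssum (fun w r => insert e h (fun t => Phi (g w :: t)) r) s.

(* Up to a sign depending only on the parities of [g] and [h], this is the brace
   operation [Phi{g, h}]. *)
Definition brace c g e h : (seq A -> W) -> seq A -> W := slide (c (+) e) (ins2_front g e h).

Lemma slide_QD c Q Q' Phi s : slide c (fun Phi s => Q Phi s + Q' Phi s) Phi s =
  slide c Q Phi s + slide c Q' Phi s.
Proof.
elim: s Phi => [|x s IH] Phi; first by rewrite !slide_head /= !addr0.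
by rewrite !slide_cons IH sgD addrACA.
Qed.

Lemma slide_Qsg c b Q Phi s : slide c (fun Phi s => sg b (Q Phi s)) Phi s =
  sg b (slide c Q Phi s).
Proof.
elim: s Phi => [|x s IH] Phi; first by rewrite !slide_head /= !addr0.
by rewrite !slide_cons IH sgD !sgA addbC.
Qed.

Lemma insert_front_lin e h Phi r a x y : mlinear Phi ->
  insert e h (fun t => Phi (a *: x + y :: t)) r =
  a *: insert e h (fun t => Phi (x :: t)) r + insert e h (fun t => Phi (y :: t)) r.
Proof.
move=> mP; rewrite -insert_lin; congr (insert _ _ _ _).
by apply/funext=> t; exact: (mP _ _ _ [::]).
Qed.

Lemma insert_front_morph e h Phi r : mlinear Phi ->
  {morph (fun x => insert e h (fun t => Phi (x :: t)) r) : x y / x + y}.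
Proof.
by move=> mP x y /=; rewrite -{1}[x]scale1r insert_front_lin // scale1r.
Qed.

Lemma ins2_front_lin g e h : linQ (ins2_front g e h).
Proof.
move=> a Phi Psi s; rewrite /ins2_front (morph_ssum (scalerDr a)) -ssumD.
by apply: eq_ssum => u v _; rewrite insert_lin.
Qed.

Lemma ins2_front_ext g e h : extQ (ins2_front g e h).
Proof.
move=> Phi Psi s E; apply: eq_ssum => u v _; congr (insert _ _ _ _).
exact/funext.
Qed.

Lemma ins2_front_mlinear g e h Phi : mlinear g -> mlinear h -> mlinear Phi ->
  mlinear (ins2_front g e h Phi).
Proof.
move=> mg mh mP; apply: ssum_mlinear => [v a x y s1 s2|u];
  first by rewrite mg insert_front_lin.
by apply: insert_mlinear => //; exact: mlinear_cons.
Qed.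

Lemma ins2_front_vanish1 g e h Phi : vanish1 g -> vanish1 h -> mlinear Phi ->
  vanish1 Phi -> vanish1 (ins2_front g e h Phi).
Proof.
move=> ng nh mP nP; apply: ssum_vanish1 => [v s1 s2|u].
  by rewrite ng (morph0 (insert_front_morph e h v mP)).
by apply: insert_vanish1; [| exact: mlinear_cons | exact: vanish1_cons].
Qed.

Lemma brace_lin c g e h : linQ (brace c g e h).
Proof. exact/slide_lin/ins2_front_lin. Qed.

Lemma brace_mlinear c g e h Phi : mlinear g -> mlinear h -> mlinear Phi ->
  mlinear (brace c g e h Phi).
Proof.
by move=> mg mh; apply: slide_mlinear; [exact: ins2_front_lin | move=> Psi;
  exact: ins2_front_mlinear].
Qed.

Lemma brace_vanish1 c g e h Phi : vanish1 g -> vanish1 h -> mlinear Phi ->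
  vanish1 Phi -> vanish1 (brace c g e h Phi).
Proof.
by move=> ng nh; apply: slide_vanish1; [exact: ins2_front_lin | move=> Psi;
  exact: ins2_front_vanish1].
Qed.

Lemma brace_supported c g e h (D E1 E2 F : nat -> Prop) Phi : supported E1 g ->
  supported E2 h ->
  mlinear Phi -> (forall i j1 j2, D (i + 2)%N -> E1 j1 -> E2 j2 -> F (i + (j1 + j2))%N) ->
  supported D Phi -> supported F (brace c g e h Phi).
Proof.
move=> s1 s2 mP DEF; pose E j := exists j1 j2, [/\ j = (j1 + j2)%N, E1 j1 & E2 j2].
apply: (slide_supported (o := 2) (E := E)) => // [|i j Di [j1 [j2 [-> ? ?]]]];
  last exact: DEF.
move=> Psi D' F' mPsi DEF' sP s /ssum_neq0 [w [r [-> ne]]]; rewrite size_cat.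
have E1w : E1 (size w).
  apply: s1; apply: contraNneq ne => ->.
  by rewrite (morph0 (insert_front_morph e h r mPsi)).
apply: (insert_supported (D := fun n => D' n.+1) (F := fun n => F' (size w + n)%N)
  s2 (mlinear_cons (g w) mPsi) _ _ ne) => [i j Di E2j|t /sP //].
by rewrite addnCA; apply: DEF'; [rewrite addnS | exists (size w), j].
Qed.

(** Beyond the terms known from a single insertion, the outputs of [g] and [h] are multiplied when
    they are neighbours. By coassociativity of the splittings this inserts [cup g h] as one
    block. *)
Lemma ins2_front_dmid c g e h Phi s : parity (~~ c) g -> parity (~~ e) h -> mlinear Phi ->
  dmid (ins2_front g e h Phi) s = sg (c (+) e) (ins2_front g e h (dmid Phi) s)
     + (ins2_front (hdiff g) e h Phi s + sg (~~ c) (ins2_front g (~~ e) (hdiff h) Phi s)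
        + sg (c (+) e) (ins_front (cup g h) Phi s))
     - on_head (fun x s' => ins2_front g e h (on_head (fun y t => Phi (x * y :: t))) s') s.
Proof.
move=> pg ph mP; have mI r := insert_front_morph e h r mP.
have mJ r := insert_front_morph (~~ e) (hdiff h) r mP.
have -> : on_head (fun x s' => ins2_front g e h (on_head (fun y t => Phi (x * y ::
  t))) s') s =
    ssum (fun w r => insert e h (fun t => Phi (dleft g w :: t)) r) s.
  rewrite -ssum_head_l; apply: eq_ssum => w y _; rewrite /dleft.
  by rewrite (morph_on_head (mI y)).
have E1 : ssum (fun w r => on_head
      (fun z r' => insert e h (fun t => Phi (g w * z :: t)) r') r) s =
    ssum (fun w r => insert e h (fun t => Phi (dright g w :: t)) r) s.
  rewrite ssum_head_r -ssum_last_l; apply: eq_ssum => w r _.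
  by rewrite /dright (morph_on_last (mI r)).
have E2 : ins_front (cup g h) Phi s =
    ssum (fun w r => ssum (fun y z => Phi (g w * h y :: z)) r) s.
  rewrite ssum_assoc; apply: eq_ssum => w r _.
  exact: (morph_ssum (mlinear_morph [::] r mP)).
rewrite dmid_ssum E2 /ins2_front -!ssum_sg -ssumN.
transitivity (ssum (fun w r => insert e h (fun t => Phi (dmid g w :: t)) r
    + sg (~~ c) (sg e (insert e h (dmid (fun t => Phi (g w :: t))) r)
                 + insert (~~ e) (hdiff h) (fun t => Phi (g w :: t)) r)) s).
  apply: eq_ssum => w r _; rewrite (dmid_morph _ _ (mI r)); congr (_ + _).
  rewrite insert_dmid //; last exact: mlinear_cons.
  have [->|/pg ->//] := eqVneq (g w) 0.
  rewrite (_ : (fun t => Phi _) = fun=> 0).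
    rewrite (_ : dmid _ = fun=> 0); last by apply/funext=> t; rewrite dmid0.
    by rewrite !linQ0 ?(sg0, addr0) //; exact: insert_lin.
  by apply/funext=> t; rewrite (mlinear0 [::]).
(* As for a single block, [E1] is an equality of sums, and the rest holds for each splitting. *)
apply: (addIr (sg c (ssum (fun w r => on_head
      (fun z r' => insert e h (fun t => Phi (g w * z :: t)) r') r) s))).
rewrite {1}E1 -!ssum_sg -!ssumD; apply: eq_ssum => w r _.
have -> : insert e h (fun t => dmid Phi (g w :: t)) r =
   - ssum (fun y z => Phi (g w * h y :: z)) r
   - sg e (on_head (fun z r' => insert e h (fun t => Phi (g w * z :: t)) r') r)
   - insert e h (dmid (fun t => Phi (g w :: t))) r.
  rewrite (_ : (fun t => dmid _ _) = fun t => sg true (on_head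
    (fun z t => Phi (g w * z :: t)) t) + sg true (dmid (fun t => Phi (g w :: t)) t));
      last first.
    by apply/funext.
  rewrite (linQD _ _ _ (insert_lin e h)) !(linQsg _ _ _ (insert_lin e h)).
  rewrite [insert e h (on_head _) r]slide_head /= opprD.
  congr (_ - _ - _); exact: on_head_sg.
rewrite /hdiff !mI (morph_sg (mI r)).
have -> : sg (odd (size w)) (insert e h (fun t => Phi (dright g w :: t)) r) =
    sg c (insert e h (fun t => Phi (dright g w :: t)) r).
  have [->|r0] := eqVneq (dright g w) 0; first by rewrite (morph0 (mI r)) !sg0.
  congr (sg _ _); have /dright_supported - /(_ (fun n => odd n = c)) := pg.
  by apply=> // i /= ->; rewrite negbK.
rewrite !sgB !sgD !sgN !sgA -addbA addbb addbF addNb !sgNb /=.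
by rewrite /=; abel.
Qed.

Lemma brace_dmid c g e h Phi s : parity (~~ c) g -> parity (~~ e) h -> mlinear Phi ->
  dmid (brace c g e h Phi) s = sg (c (+) e) (brace c g e h (dmid Phi) s)
     + (brace (~~ c) (hdiff g) e h Phi s + sg (~~ c) (brace c g (~~ e) (hdiff h) Phi s)
        + sg (c (+) e) (insert (~~ (c (+) e)) (cup g h) Phi s)).
Proof.
move=> pg ph mP.
rewrite /brace (slide_dmid (c := c (+) e) (Q := ins2_front g e h) (Q' := fun Phi s =>
  ins2_front (hdiff g) e h Phi s + sg (~~ c) (ins2_front g (~~ e) (hdiff h) Phi s)
        + sg (c (+) e) (ins_front (cup g h) Phi s))) //.
- by rewrite !slide_QD !slide_Qsg addNb addbN.
- exact: ins2_front_lin.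
- by move=> Psi t mPsi; exact: ins2_front_dmid.
Qed.

Lemma ins2_front_size_sg c g e h Phi s : parity (~~ c) g -> parity (~~ e) h ->
  mlinear Phi ->
  ins2_front g e h (fun t => sg (odd (size t)) (Phi t)) s =
  sg (odd (size s) (+) (c (+) e)) (ins2_front g e h Phi s).
Proof.
move=> pg ph mP; rewrite /ins2_front -ssum_sg; apply: eq_ssum => u v ->.
rewrite (_ : (fun t => _) = fun t => sg true (sg (odd (size t)) (Phi (g u :: t))));
  last first.
  by apply/funext=> t; rewrite sgNb.
rewrite (linQsg _ _ _ (insert_lin e h)) insert_size_sg //; last exact: mlinear_cons.
have [->|/pg] := eqVneq (g u) 0.
  by rewrite (morph0 (insert_front_morph e h v mP)) !sg0.
by rewrite size_cat oddD sgA => ->; congr sg; case: odd; case: (c); case: (e).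
Qed.

Lemma brace_size_sg c g e h Phi s : parity (~~ c) g -> parity (~~ e) h -> mlinear Phi ->
  brace c g e h (fun t => sg (odd (size t)) (Phi t)) s =
  sg (odd (size s) (+) (c (+) e)) (brace c g e h Phi s).
Proof.
move=> pg ph mP; apply: slide_size_sg => // [|Psi t mPsi]; first exact: ins2_front_lin.
exact: ins2_front_size_sg.
Qed.

End Ins.

Lemma brace_dleft c g e h f s :
  brace c g e h (dleft f) s = cup g (insert e h f) s + sg (c (+) e)
    (dleft (brace c g e h f) s).
Proof.
have mE e' h' x r : insert e' h' (fun t => x * f t) r = x * insert e' h' f r.
  exact: (insert_morph e' h' f r (mulr_morph x)).
rewrite /brace slide_head; congr (_ + _).
  by apply: eq_ssum => u v _; exact: mE.
rewrite on_head_sg; congr sg.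
apply: on_headE => x s' _; elim: s' (f) {mE} => [|y s' IH] f'.
  rewrite !slide_head /= !addr0 /ins2_front /= !addr0.
  exact: (insert_morph e h (fun t => f' (g [::] :: t)) [::] (mulr_morph x)).
rewrite !slide_cons mulrDr [X in _ = _ + X](morph_sg (mulr_morph x)) /dleft /= IH;
  congr (_ + _).
rewrite /ins2_front (morph_ssum (mulr_morph x)); apply: eq_ssum => u v _.
exact: (insert_morph e h (fun t => f' (g u :: t)) v (mulr_morph x)).
Qed.

Lemma signed_cupD c f f' g s :
  signed_cup c (fun t => f t + f' t) g s = signed_cup c f g s + signed_cup c f' g s.
Proof. by rewrite /signed_cup -ssumD; apply: eq_ssum => u v _; rewrite mulrDl sgD. Qed.

Lemma signed_cup_sg b c f g s : signed_cup c (fun t => sg b (f t))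
  g s = sg b (signed_cup c f g s).
Proof.
rewrite /signed_cup -ssum_sg; apply: eq_ssum => u v _.
by rewrite [sg b (f u) * _](morph_sg (mull_morph (g v))) !sgA addbC.
Qed.

Lemma brace_dright c g e h f s : parity (~~ c) g -> mlinear f ->
  brace c g e h (dright f) s =
  dright (brace c g e h f) s + sg (e && ~~ c) (signed_cup e (insert c g f) h s).
Proof.
move=> pg mf; pose R f s := ssum (fun w r => signed_cup e (fun t => f (g w :: t)) h r) s.
rewrite /brace (@slide_dright _ _ (c (+) e) _ R).
- congr (_ + _); elim: s f mf => [|x s IH] f mf.
    rewrite slide_head /= /R /= /signed_cup /= andbF !addr0 /insert slide_head
      /ins_front /= !addr0.
    have [->|/pg /= <-] := eqVneq (g [::]) 0; last by rewrite andbF.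
    by rewrite (mlinear0 [::]) // mul0r sg0.
  rewrite slide_cons IH; last exact: mlinear_cons.
  have -> : R f (x :: s) = sg (e && ~~ c) (signed_cup e (ins_front g f) h (x :: s)).
    transitivity (ssum (fun t z => ssum (fun w y =>
        sg (e && odd (size y)) (f (g w :: y) * h z)) t) (x :: s)).
      by rewrite -(ssum_assoc (fun w y z => sg (e && odd (size y)) (f (g w :: y) * h z))).
    rewrite /signed_cup -ssum_sg; apply: eq_ssum => t z _.
    rewrite /ins_front (morph_ssum (mull_morph (h z))) -!ssum_sg.
    apply: eq_ssum => w y ->; have [->|/pg] := eqVneq (g w) 0.
      by rewrite (mlinear0 [::]) // mul0r !sg0.
    by rewrite size_cat oddD sgA => ->; congr sg; case: (e); case: (c); case: odd.
  rewrite !signed_cup_cons [insert c g f [::]]slide_head /= addr0.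
  rewrite (_ : (fun t => insert c g f (x :: t)) = fun t => ins_front g f (x :: t) +
     sg c (insert c g (fun t => f (x :: t)) t)); last by apply/funext=> t;
       rewrite -slide_cons.
  rewrite (signed_cupD _ (fun t => ins_front g f (x ::
    t)) (fun t => sg c _)) signed_cup_sg !sgD !sgA -!addrA; congr (_ + (_ + sg _ _)).
  by case: (e); case: (c).
- exact: ins2_front_lin.
- exact: ins2_front_ext.
move=> {s f mf} f s; rewrite /R.
rewrite [dright _ _](_ : _ = ssum (fun w r =>
    dright (insert e h (fun t => f (g w :: t))) r) s); last first.
  rewrite ssum_last_r /dright; apply: on_lastE => s' x _.
  exact: (morph_ssum (mull_morph x)).
rewrite -ssumD; apply: eq_ssum => w r _; rewrite -insert_dright.
by apply: slide_ext; [exact: ins_front_ext | ].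
Qed.

(** The three products have three sources: [g] as the left factor in [dleft f], [h] as the right
    factor in [dright f], and neighbouring outputs of [g] and [h] multiplied by [dmid f]. *)
Lemma brace_hdiff c b e g h f s : mlinear f -> parity (~~ c) g -> parity (~~ e) h ->
  parity b f ->
  brace c g e h (hdiff f) s =
    cup g (insert e h f) s + sg (c (+) e) (hdiff (brace c g e h f) s)
    - sg (c (+) e) (brace (~~ c) (hdiff g) e h f s)
    + sg e (brace c g (~~ e) (hdiff h) f s)
    - insert (~~ (c (+) e)) (cup g h) f s
    + sg (~~ b && ~~ e) (cup (insert c g f) h s).
Proof.
move=> mf pg ph pf; have lI := @brace_lin A c g e h.
rewrite [X in brace c g e h X](_ : _ = fun t => (dleft f t + dmid f t) +
  sg (odd (size t)) (dright f t)); last by apply/funext.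
rewrite !(linQD _ _ _ lI) brace_dleft brace_size_sg //; last exact: dright_mlinear.
have pI := insert_parity mf pg pf.
rewrite brace_dright // (signed_cup_parity _ _ _ pI) /hdiff brace_dmid //
  !sgD !sgA addbb /=.
rewrite -addbA (parity_sg_add _ _ (cup_parity pI ph)).
have -> : b (+) c (+) ~~ e (+) (c (+) e (+) (e && ~~ c (+) e && (b (+) c))) =
  ~~ b && ~~ e by case: (b); case: (c); case: (e).
have -> : c (+) e (+) ~~ c = ~~ e by case: (c); case: (e).
by rewrite (addbC (c (+) e)) !sgNb; abel.
Qed.

End Brace.

(** * Cyclic words *)

Section Cyclic.
Variables (k : fieldType) (A : falgType k).
Implicit Types (s t u v w : seq A) (b c e : bool) (a : k).
Implicit Types (f g h : seq A -> A).

Section Target.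
Variable W : lmodType k.
Implicit Types (Phi : seq A -> W) (Psi : seq A -> A -> seq A -> W) (ka : A -> seq A -> W).

Lemma dmid_mid Phi v x r : dmid Phi (v ++ x :: r) =
  dmid (fun v => Phi (v ++ x :: r)) v
  + sg (odd (size v)) (on_last (fun v y => Phi (v ++ y * x :: r)) v
     - on_head (fun y r => Phi (v ++ x * y :: r)) r - dmid (fun r => Phi (v ++ x :: r)) r).
Proof.
elim: v Phi => [|z v IH] Phi.
  by rewrite [X in X + _]/= !add0r dmid_cons.
rewrite cat_cons !dmid_cons (IH (fun t => Phi (z :: t))) /= sgNb.
by case: v {IH} => [|y v] /=; abel.
Qed.

Lemma dmid_sg_even c Phi s :
  dmid (fun t => sg (c && ~~ odd (size t)) (Phi t)) s = sg (c && odd (size s)) (dmid Phi s).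
Proof.
rewrite (_ : (fun t => _) = fun t => sg c (sg (odd (size t) && c) (Phi t))).
  by rewrite dmid_sg dmid_sg_odd sgA; congr sg; case: (c); case: odd.
by apply/funext=> t; rewrite sgA; congr sg; case: (c); case: odd.
Qed.

(* The cyclic words [x, s] are opened at all places: [u] is moved to the front,
   past [x] and [t]. *)
Definition cyclic_sum Psi x s : W :=
  ssum (fun t u => sg (odd (size u) && ~~ odd (size t)) (Psi u x t)) s.

(** The transpose of the Hochschild boundary on chains, [x] being the letter number 0; equivalently,
    the Hochschild differential of cochains with values in a dual of the algebra. In the last term
    the word closes up cyclically. *)
Definition dcyc ka x s : W :=
  on_head (fun y s' => ka (x * y) s') s + dmid (ka x) s
  + sg (odd (size s)) (on_last (fun s' y => ka (y * x) s') s).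

Lemma dcyc_sum Psi x s : dcyc (cyclic_sum Psi) x s =
  ssum (fun t u => sg (odd (size u) && odd (size t))
    (on_head (fun y t' => Psi u (x * y) t') t + dmid (Psi u x) t
     - sg (odd (size u)) (dmid (fun u => Psi u x t) u)
     - on_last (fun u' y => Psi u' (y * x) t) u)) s.
Proof.
rewrite /dcyc /cyclic_sum dmid_ssum -ssum_head_l -ssum_last_r -ssum_sg -!ssumD.
apply: eq_ssum => t u ->; rewrite size_cat oddD dmid_sg_even dmid_sg_odd !sgD !sgN !sgA.
rewrite [on_head _ t](_ : _ = sg (odd (size u) && odd (size t))
  (on_head (fun y t' => Psi u (x * y) t') t)); last first.
  by rewrite -on_head_sg; apply: on_headE => y t' ->.
rewrite [on_last _ u](_ : _ = sg (~~ odd (size u) && ~~ odd (size t))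
  (on_last (fun u' y => Psi u' (y * x) t) u)); last first.
  by rewrite -on_last_sg; apply: on_lastE => u' y ->; rewrite size_rcons /= negbK.
rewrite sgA -!addrA; congr (_ + (_ + _)); rewrite -!sgNb.
by congr (sg _ _ + sg _ _); case: odd; case: odd.
Qed.

Definition cyc Phi x s : W := cyclic_sum (fun u x t => Phi (u ++ x :: t)) x s.

(** The transpose of the identity [N b = b' N] of cyclic homology, where [b'] is the Hochschild
    boundary without its cyclic term; [dmid] is minus the transpose of [b']. *)
Lemma dcyc_cyc Phi x s : dcyc (cyc Phi) x s = - cyc (dmid Phi) x s.
Proof.
rewrite /cyc dcyc_sum -ssumN; apply: eq_ssum => t u _.
rewrite dmid_mid.
by case: (odd (size u)); case: (odd (size t)); rewrite /=; abel.
Qed.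

(* [g] is only inserted after the distinguished letter [x]: the words have the
   cyclic order (output of [Phi], [x], [g]). Among the boundary terms, the output
   next to [x] gives [Phi o g], [g] next to [x] gives [g] cup [Delta Phi], and [g]
   next to the output gives one half of [Delta] of the cup product. *)
Definition cyc_insert c g Phi x s : W :=
  cyclic_sum (fun u x t =>
    sg (c && ~~ odd (size u)) (insert c g (fun r => Phi (u ++ x :: r)) t)) x s.

Lemma mlinear_mid Phi u x : mlinear Phi -> mlinear (fun r => Phi (u ++ x :: r)).
Proof.
move=> mP a y z s1 s2.
have E r : u ++ x :: s1 ++ r :: s2 = (u ++ x :: s1) ++ r :: s2 by rewrite -catA.
by rewrite !E mP.
Qed.

Lemma mlinear_left Phi r : mlinear Phi -> mlinear (fun u => Phi (u ++ r)).
Proof. by move=> mP a y z s1 s2; rewrite -!catA !cat_cons mP. Qed.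

Lemma insert_dmid_swap c g (F : seq A -> seq A -> W) u t :
  dmid (fun u => insert c g (F u) t) u = insert c g (fun r => dmid (fun u => F u r) u) t.
Proof.
have lI := @insert_lin _ A W c g.
elim: u F => [|x u IH] F; first by rewrite [RHS](linQ0 _ lI).
rewrite dmid_cons (IH (fun u => F (x :: u))) [RHS](_ : _ = insert c g (fun r =>
   sg true (on_head (fun y u' => F (x * y :: u') r) u) +
   sg true (dmid (fun u => F (x :: u) r) u)) t) //.
rewrite (linQD _ _ _ lI) !(linQsg _ _ _ lI) /=; congr (- _ - _).
by case: u {IH} => [|y u] //=; rewrite (linQ0 _ lI).
Qed.

Lemma insert_last_swap c g (F : seq A -> A -> seq A -> W) u t :
  insert c g (fun r => on_last (fun u y => F u y r) u) t =
  on_last (fun u y => insert c g (F u y) t) u.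
Proof. by case: u => //=; rewrite (linQ0 _ (@insert_lin _ A W c g)). Qed.

(** The last sum is the product of [x] with the output of [g]. It occurs in [dmid Phi] when [g]
    stands right after [x], but [dcyc] only multiplies [x] with letters of the word. *)
Lemma dcyc_insert c g Phi x s : parity (~~ c) g -> mlinear Phi ->
  dcyc (cyc_insert c g Phi) x s =
  - sg c (cyc_insert c g (dmid Phi) x s) - cyc_insert (~~ c) (hdiff g) Phi x s
  - ssum (fun t u => sg ((odd (size u) && odd (size t)) (+) (c && odd (size u)))
      (ssum (fun w y => Phi (u ++ x * g w :: y)) t)) s.
Proof.
move=> pg mP; have lI := @insert_lin _ A W c g.
rewrite /cyc_insert dcyc_sum -ssum_sg -!ssumN -!ssumD; apply: eq_ssum => t u _.
have -> : insert c g (fun r => dmid Phi (u ++ x :: r)) t =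
   insert c g (fun r => dmid (fun u => Phi (u ++ x :: r)) u) t +
   sg (odd (size u)) (on_last (fun u y => insert c g (fun r => Phi (u ++ y * x :: r)) t) u
     - (ssum (fun w y => Phi (u ++ x * g w :: y)) t +
        sg c (on_head (fun y t => insert c g (fun r => Phi (u ++ x * y :: r)) t) t))
     - insert c g (dmid (fun r => Phi (u ++ x :: r))) t).
  rewrite (_ : (fun r => dmid Phi _) = fun r => dmid (fun u => Phi (u ++ x :: r)) u +
    sg (odd (size u)) ((on_last (fun u y => Phi (u ++ y * x :: r)) u
     + sg true (on_head (fun y r => Phi (u ++ x * y :: r)) r)) +
       sg true (dmid (fun r => Phi (u ++ x :: r)) r))); last first.
    by apply/funext=> r; exact: dmid_mid.
  rewrite (linQD _ _ _ lI) (linQsg _ _ _ lI) !(linQD _ _ _ lI) !(linQsg _ _ _ lI).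
  rewrite insert_last_swap /=; congr (_ + sg _ (_ - _ - _)).
  by rewrite /insert slide_head on_head_sg.
rewrite dmid_sg insert_dmid //; last exact: mlinear_mid.
rewrite dmid_sg_even insert_dmid_swap on_head_sg.
rewrite [on_last _ u in LHS](_ : _ = sg (c && odd (size u))
  (on_last (fun u y => insert c g (fun r => Phi (u ++ y * x :: r)) t) u)); last first.
  by rewrite -on_last_sg; apply: on_lastE => u' y ->; rewrite size_rcons.
by case: (c); case: (odd (size u)); case: (odd (size t)); rewrite /=; abel.
Qed.

End Target.

(** * Cochains as functionals on cyclic words through a trace *)

Section Trace.
Variable tr : A -> k^o.
Hypothesis trD : {morph tr : x y / x + y}.
Hypothesis trZ : forall a x, tr (a *: x) = a *: tr x.
Hypothesis trC : forall x y, tr (x * y) = tr (y * x).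

Lemma tr_mlinear f : mlinear f -> mlinear (fun s => tr (f s)).
Proof. by move=> mf a x y s1 s2; rewrite mf trD trZ. Qed.

(** [trC] serves to bring the right factor of [dright f] around the cyclic word to the left of
    [x]. *)
Lemma dcyc_tr f x s : dcyc (fun x s => tr (x * f s)) x s = tr (x * hdiff f s).
Proof.
rewrite /dcyc /hdiff !mulrDr !trD; congr (_ + _ + _).
- rewrite /dleft; case: s => [|y s] /=; first by rewrite mulr0 (morph0 trD).
  by rewrite mulrA.
- by apply: (dmid_morph _ _ (h := fun y => tr (x * y))) => y z; rewrite mulrDr trD.
rewrite (morph_sg (mulr_morph x)) (morph_sg trD); congr sg.
case/lastP: s => [|s y]; first by rewrite /dright /= mulr0 (morph0 trD).
by rewrite /dright !on_last_rcons mulrA [RHS]trC mulrA.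
Qed.

Lemma cyc_lin : forall x, linQ (fun Phi : seq A -> k^o => cyc Phi x).
Proof.
move=> x a Phi Psi s; rewrite /cyc /cyclic_sum (morph_ssum (scalerDr a)) -ssumD.
by apply: eq_ssum => u v _; rewrite sgD sgZ.
Qed.

Lemma dleft_mid f u x t :
  dleft f (u ++ x :: t) = if u is y :: u' then y * f (u' ++ x :: t) else x * f t.
Proof. by case: u. Qed.

Lemma dright_mid f u x t : dright f (u ++ x :: t) =
  (if t is [::] then f u * x else 0) + on_last (fun t y => f (u ++ x :: t) * y) t.
Proof.
case/lastP: t => [|t y]; first by rewrite cats1 /dright on_last_rcons /= addr0.
rewrite -rcons_cons -rcons_cat /dright !on_last_rcons.
by case: t => *; rewrite add0r.
Qed.

(** By [trC] a letter that multiplies from the left is the letter that multiplies from the right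
    after one rotation, and the two signs are opposite. *)
Lemma cyc_dleft_dright f x s :
  cyc (fun s => tr (dleft f s)) x s + cyc (fun s => tr (sg (odd (size s))
    (dright f s))) x s = 0.
Proof.
pose G t y u := sg (~~ odd (size u) && ~~ odd (size t)) (tr (y * f (u ++ x :: t))).
have -> : cyc (fun s => tr (dleft f s)) x s = tr (x * f s) + msum G s.
  rewrite -(ssum_nil_r (fun s => tr (x * f s))); apply: eq_ssum => t u _.
  by rewrite dleft_mid; case: u.
have -> : cyc (fun s => tr (sg (odd (size s)) (dright f s))) x s = - tr (x * f s)
  - msum G s.
  rewrite -(ssum_nil_l (fun s => tr (x * f s))) -ssum_last_l -!ssumN -ssumD.
  apply: eq_ssum => t u _; rewrite dright_mid (morph_sg trD) trD.
  rewrite size_cat /= addnS oddS oddD; case/lastP: t => [|t y].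
    by rewrite (morph0 trD) trC andbT !addr0; case: odd => /=; rewrite ?opprK oppr0 addr0.
  rewrite !on_last_rcons /G size_rcons trC.
  rewrite (_ : (if rcons t y is [::] then _ else 0) = 0); last by case: (t).
  rewrite (_ : (if rcons t y is [::] then _ else 0) = 0); last by case: (t).
  by rewrite (morph0 trD) /=; case: (odd (size u)); case: (odd (size t)); rewrite /=; abel.
by abel.
Qed.

Lemma cyc_hdiff f x s : 
  cyc (fun s => tr (hdiff f s)) x s = - dcyc (cyc (fun s => tr (f s))) x s.
Proof.
rewrite dcyc_cyc opprK -[RHS]add0r -(cyc_dleft_dright f x s) -!(linQD _ _ _ (cyc_lin x)).
congr (cyc _ x s); apply/funext=> t; rewrite /hdiff !trD (dmid_morph _ _ trD).
by abel.
Qed.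

(* The terms of [cyc (tr o (f cup g))] in which [x] is an argument of [f]. *)
Definition cyc_cup_half f g x s : k^o := cyclic_sum (fun u x t =>
  tr (cup (fun v => f (u ++ x :: v)) g t)) x s.

(** The cut of the cup product falls after [x] or before it. In the second case [trC] turns the
    product around, which exchanges the roles of [f] and [g]. *)
Lemma cyc_cup b b' f g x s : parity b f -> parity b' g ->
  cyc (fun s => tr (cup f g s)) x s = cyc_cup_half f g x s + sg (b && b')
    (cyc_cup_half g f x s).
Proof.
move=> pf pg; rewrite /cyc /cyc_cup_half /cyclic_sum addrC.
pose F t u1 u2 := sg (odd (size u1 + size u2) && ~~ odd (size t))
  (tr (f u1 * g (u2 ++ x :: t))).
transitivity (ssum (fun t u => ssum (F t) u) s +
  ssum (fun t u => sg (odd (size u) && ~~ odd (size t))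
   (tr (cup (fun v => f (u ++ x :: v)) g t))) s).
  rewrite -ssumD; apply: eq_ssum => t u _; rewrite /cup ssum_cat_mid trD sgD.
  congr (_ + _); rewrite (morph_ssum trD) -ssum_sg; apply: eq_ssum => u1 u2 ->.
  by rewrite size_cat.
congr (_ + _); rewrite ssum_assoc -ssum_sg; apply: eq_ssum => t u2 _.
rewrite (morph_ssum trD) -!ssum_sg; apply: eq_ssum => t' u1 ->.
rewrite /F trC; have [->|/pf <-] := eqVneq (f u1) 0.
  by rewrite mulr0 (morph0 trD) !sg0.
have [->|/pg <-] := eqVneq (g (u2 ++ x :: t')) 0.
  by rewrite mul0r (morph0 trD) !sg0.
rewrite sgA !size_cat /= addnS oddS !oddD.
by congr sg; case: odd; case: odd; case: odd.
Qed.

Lemma cyc_insert_lin c g x : linQ (fun Phi : seq A -> k^o => cyc_insert c g Phi x).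
Proof.
move=> a Phi Psi s; rewrite /cyc_insert /cyclic_sum (morph_ssum (scalerDr a)) -ssumD.
by apply: eq_ssum => u v _; rewrite (@insert_lin _ A k^o c g) !sgD !sgZ.
Qed.

(** The cancellation of [cyc_dleft_dright], now with two leftovers. When [x] is the left factor it
    has no partner, because an inserted output always follows [x] and keeps it from being the right
    factor. When the output of [g] is the right factor, a cup product remains. *)
Lemma cyc_insert_dleft_dright b c f g x s : mlinear f -> parity b f -> parity (~~ c) g ->
  cyc_insert c g (fun s => tr (dleft f s)) x s
  + cyc_insert c g (fun s => tr (sg (odd (size s)) (dright f s))) x s =
  sg c (tr (x * insert c g f s)) - sg (b && ~~ c) (cyc_cup_half f g x s).
Proof.
move=> mf pf pg; have lI := @insert_lin _ A k^o c g.
pose G t y u := sg ((~~ odd (size u) && ~~ odd (size t)) (+) (c && odd (size u)))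
  (tr (y * insert c g (fun r => f (u ++ x :: r)) t)).
have mE y f' r : insert c g (fun q => tr (y * f' q)) r = tr (y * insert c g f' r).
  by apply: (insert_morph _ _ _ _ (h := fun z => tr (y * z))) => z z'; rewrite mulrDr trD.
have -> : cyc_insert c g (fun s => tr (dleft f s)) x s =
    sg c (tr (x * insert c g f s)) + msum G s.
  rewrite -(ssum_nil_r (fun s => sg c (tr (x * insert c g f s)))).
  apply: eq_ssum => t [|y u] _ /=.
    by rewrite andbT -mE.
  by rewrite sgA /G negbK -mE.
have -> : cyc_insert c g (fun s => tr (sg (odd (size s)) (dright f s))) x s =
   - msum G s - sg (b && ~~ c) (cyc_cup_half f g x s).
  rewrite /cyc_cup_half -ssum_sg -ssum_last_l -!ssumN -ssumD; apply: eq_ssum => t u _.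
  pose fx r := f (u ++ x :: r).
  have mfx : mlinear fx by exact: mlinear_mid.
  have pfx : parity (b (+) ~~ odd (size u)) fx.
    move=> r /pf <-; rewrite size_cat /= addnS oddS oddD.
    by case: odd; case: odd.
  rewrite (_ : (fun r => tr _) = fun r => sg (~~ odd (size u))
      (sg (odd (size r)) (tr (dright f (u ++ x :: r))))); last first.
    apply/funext=> r; rewrite (morph_sg trD) sgA size_cat /= addnS oddS oddD.
    by congr sg; case: odd; case: odd.
  rewrite (linQsg _ _ _ lI) insert_size_sg //; last first.
    by apply: (mlinear_mid u x (Phi := fun r => tr (dright f r)));
      apply/tr_mlinear/dright_mlinear.
  rewrite (insert_morph _ _ _ _ trD).
  (* After an insertion the word behind [x] is nonempty, so the letter split off by [dright] is
     never [x]. *)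
  rewrite (_ : insert c g _ t = insert c g (dright fx) t); last first.
    by apply: slide_ext => [|y r]; [exact: ins_front_ext | rewrite dright_mid add0r].
  rewrite insert_dright (signed_cup_parity _ _ _ pfx) trD (morph_sg trD).
  have -> : on_last (fun t y => G t y u) t =
      sg ((~~ odd (size u) && odd (size t)) (+) (c && odd (size u)))
        (tr (dright (insert c g fx) t)).
    rewrite /dright (morph_on_last trD) -on_last_sg; apply: on_lastE => t' y ->.
    by rewrite size_rcons /G trC.
  change (fun v => f (u ++ x :: v)) with fx.
  have [->|/(cup_parity pfx pg) ->] := eqVneq (cup fx g t) 0.
    rewrite (morph0 trD) !sg0 addr0 subr0.
    by case: (c); case: (odd (size t)); case: (odd (size u)); rewrite /=; abel.
  by case: (b); case: (c); case: (odd (size u)); rewrite /=; abel.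
by abel.
Qed.

Lemma cyc_insert_hdiff b c f g x s : mlinear f -> parity b f -> parity (~~ c) g ->
  cyc_insert c g (fun s => tr (hdiff f s)) x s =
  cyc_insert c g (dmid (fun s => tr (f s))) x s
  + sg c (tr (x * insert c g f s)) - sg (b && ~~ c) (cyc_cup_half f g x s).
Proof.
move=> mf pf pg; have lC := cyc_insert_lin c g x.
rewrite -addrA -cyc_insert_dleft_dright // -!(linQD _ _ _ lC).
congr (cyc_insert _ _ _ x s); apply/funext=> t; rewrite /hdiff !trD (dmid_morph _ _ trD).
by abel.
Qed.

(* By [DelE] below, the hypothesis holds for [D := Delta f]. *)
Lemma cyc_insert_cup c f g D x s : mlinear f -> parity (~~ c) g ->
  (forall x s, tr (x * D s) = cyc (fun s => tr (f s)) x s) ->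
  ssum (fun t u => sg ((odd (size u) && odd (size t)) (+) (c && odd (size u)))
      (ssum (fun w y => tr (f (u ++ x * g w :: y))) t)) s = tr (x * cup g D s).
Proof.
move=> mf pg DE; rewrite (morph_ssum (mulr_morph x)) (morph_ssum trD).
transitivity (ssum (fun w r => ssum (fun y u => sg (odd (size u) && ~~ odd (size y))
    (tr (f (u ++ x * g w :: y)))) r) s); last first.
  by apply: eq_ssum => w r _; rewrite mulrA DE.
rewrite ssum_assoc; apply: eq_ssum => t u _; rewrite -ssum_sg.
apply: eq_ssum => w y ->; rewrite size_cat oddD.
have [->|/pg ->] := eqVneq (g w) 0; first by rewrite mulr0 (mlinear0 _ _ mf)
  (morph0 trD) !sg0.
by congr sg; case: (c); case: odd; case: odd.
Qed.

Lemma dcyc_insert_tr b c f g D x s : mlinear f -> parity b f -> parity (~~ c) g ->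
  (forall x s, tr (x * D s) = cyc (fun s => tr (f s)) x s) ->
  dcyc (cyc_insert c g (fun s => tr (f s))) x s =
  - sg c (cyc_insert c g (fun s => tr (hdiff f s)) x s)
  - cyc_insert (~~ c) (hdiff g) (fun s => tr (f s)) x s
  + tr (x * insert c g f s) - sg (c (+) (b && ~~ c)) (cyc_cup_half f g x s)
  - tr (x * cup g D s).
Proof.
move=> mf pf pg DE; rewrite dcyc_insert //; last exact: tr_mlinear.
rewrite (cyc_insert_cup _ _ mf pg DE) (cyc_insert_hdiff _ _ mf pf pg)
  !sgD sgN !sgA addbb /=.
by abel.
Qed.

End Trace.
End Cyclic.

Arguments ins_front : simpl never.
Arguments ins2_front : simpl never.
Arguments ssum : simpl never.

(** * Leibniz rule, square of the differential, linearity *)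

Section Raw.
Variables (k : fieldType) (A : falgType k).
Implicit Types (s t u v w : seq A) (b c e : bool) (a : k).
Implicit Types (f g h : seq A -> A).

Lemma hdiff_cup b f g s : parity b f ->
  hdiff (cup f g) s = cup (hdiff f) g s + sg b (cup f (hdiff g) s).
Proof.
move=> pf.
have E1 : dleft (cup f g) s = cup (dleft f) g s.
  rewrite /dleft /cup; transitivity (ssum (fun u v => on_head (fun x u => x * (f u * g
    v)) u) s).
    by rewrite ssum_head_l; apply: on_headE => x s' _; exact: (morph_ssum (mulr_morph x)).
  apply: eq_ssum => u v _; rewrite (morph_on_head (mull_morph (g v))).
  by apply: on_headE => x u' _; rewrite mulrA.
have E2 : dright (cup f g) s = cup f (dright g) s.
  rewrite /dright /cup; transitivity (ssum (fun u v => on_last (fun v x => (f u * g v)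
    * x) v) s).
    by rewrite ssum_last_r; apply: on_lastE => s' x _; exact: (morph_ssum (mull_morph x)).
  apply: eq_ssum => u v _; rewrite (morph_on_last (mulr_morph (f u))).
  by apply: on_lastE => x u' _; rewrite mulrA.
(* A letter at the cut can multiply the value of [f] on the right or that of [g] on the left.
   Neither product occurs in [hdiff (cup f g)], and the two cancel. *)
have E3 : cup (dright f) g s = cup f (dleft g) s.
  rewrite /cup; transitivity (msum (fun u x v => f u * x * g v) s).
    rewrite -ssum_last_l; apply: eq_ssum => u v _.
    exact: (morph_on_last (mull_morph (g v))).
  rewrite -ssum_head_r; apply: eq_ssum => u v _.
  rewrite [RHS](morph_on_head (mulr_morph (f u))).
  by apply: on_headE => x v' _; rewrite mulrA.
pose R := ssum (fun u v => sg (odd (size v)) (f u * dright g v)) s.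
have E4 : sg (odd (size s)) (cup f (dright g) s) = sg b R.
  rewrite /cup /R -!ssum_sg; apply: eq_ssum => u v ->.
  have [->|/pf <-] := eqVneq (f u) 0; first by rewrite !mul0r !sg0.
  by rewrite sgA size_cat oddD.
have E5 : cup (hdiff f) g s = cup (dleft f) g s + cup (dmid f) g s + sg (~~ b)
  (cup (dright f) g s).
  rewrite /cup -ssum_sg -!ssumD; apply: eq_ssum => u v _.
  rewrite /hdiff !mulrDl [X in _ + _ + X](morph_sg (mull_morph (g v))); congr (_ + _ + _).
  have /dright_supported - /(_ (fun n => odd n = ~~ b)) := pf.
  have [->|r0 pr] := eqVneq (dright f u) 0; first by rewrite mul0r !sg0.
  by rewrite pr // => i <-.
have E6 : cup f (hdiff g) s = cup f (dleft g) s + cup f (dmid g) s + R.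
  rewrite /cup /R -!ssumD; apply: eq_ssum => u v _.
  by rewrite /hdiff !mulrDr [X in _ + _ + X](morph_sg (mulr_morph (f u))).
have E7 : dmid (cup f g) s = cup (dmid f) g s + sg b (cup f (dmid g) s).
  rewrite [LHS]dmid_ssum /cup -!ssum_sg -!ssumD; apply: eq_ssum => u v _.
  rewrite (dmid_morph _ _ (mull_morph (g v))) (dmid_morph _ _ (mulr_morph (f u))).
  by congr (_ + _); have [->|/pf ->//] := eqVneq (f u) 0; rewrite !mul0r !sg0.
rewrite {1}/hdiff E1 E2 E4 E5 E6 E7 E3.
by case: (b); rewrite /=; abel.
Qed.

Lemma dmid_dmid (W : lmodType k) (Phi : seq A -> W) s : dmid (dmid Phi) s = 0.
Proof.
elim: s Phi => [|x s IH] Phi //; rewrite dmid_cons.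
rewrite (_ : (fun t => dmid Phi (x :: t)) = fun t =>
  sg true (on_head (fun y t' => Phi (x * y :: t')) t) +
  sg true (dmid (fun t => Phi (x :: t)) t)); last by apply/funext.
rewrite dmidD !dmid_sg IH sg0 addr0; case: s {IH} => [|y s] /=;
  first by rewrite oppr0 subr0.
rewrite !dmid_cons /= (_ : on_head (fun z => _)
  s = on_head (fun z s' => Phi (x * (y * z) :: s')) s).
  by abel.
by apply: on_headE => z s' _; rewrite mulrA.
Qed.

Lemma hdiff_hdiff f s : hdiff (hdiff f) s = 0.
Proof.
(* The composites are grouped by the ends at which they multiply: [ll] on the left, [rr] and [rr']
   on the right, [lr] at both. Together with [dmid_dmid] they cancel by associativity. *)
have ll t : dleft (dleft f) t + dleft (dmid f) t + dmid (dleft f) t = 0.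
  case: t => [|x t]; first by rewrite /dleft /= !addr0.
  rewrite dmid_cons {1 2}/dleft /=.
  rewrite -[fun t => dleft f (x :: t)]/(fun t => x * f t)
    (dmid_morph _ _ (mulr_morph x)); case: t => [|y t] /=.
    by rewrite /dmid !mulr0 oppr0 !addr0.
  by rewrite mulrA; abel.
have lr t : dleft (dright f) t = dright (dleft f) t.
  case/lastP: t => [|t z] //; rewrite [RHS]/dright on_last_rcons.
  case: t => [|x t]; first by rewrite /dleft /dright /= mulr0 mul0r.
  by rewrite /dleft /dright rcons_cons /= on_last_rcons mulrA.
have lamD g h t : dleft (fun t => g t + h t) t = dleft g t + dleft h t.
  by rewrite /dleft -on_headD; apply: on_headE => x t' _; rewrite mulrDr.
have rhoD g h t : dright (fun t => g t + h t) t = dright g t + dright h t.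
  by rewrite /dright -on_lastD; apply: on_lastE => x t' _; rewrite mulrDl.
have lr' t : dleft (fun t => sg (odd (size t)) (dright f t)) t = - sg (odd (size t))
  (dleft (dright f) t).
  case: t => [|x t]; first by rewrite /= oppr0.
  by rewrite /dleft /= sgNb opprK (morph_sg (mulr_morph x)).
have br t : dmid (fun t => sg (odd (size t)) (dright f t)) t = - sg (odd (size t))
  (dmid (dright f) t).
  rewrite -sgNb -[~~ _]andbT -dmid_sg_odd; congr dmid.
  by apply/funext=> r; rewrite andbT.
have rr : sg (odd (size s)) (dmid (dright f) s) = sg (odd (size s)) (dright (dmid f) s)
    - dright (dright f) s.
  case/lastP: s => [|t z]; first by rewrite /dright /= subr0.
  rewrite -[X in dmid _ X]cats1 dmid_mid /= !subr0 [dright (dmid f) _]on_last_rcons.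
  rewrite [dright (dright f) _]on_last_rcons size_rcons /= !sgNb.
  rewrite (_ : (fun v => dright f (v ++ [:: z])) = fun v => f v * z); last first.
    by apply/funext=> v; rewrite cats1 /dright on_last_rcons.
  rewrite (dmid_morph _ _ (mull_morph z)) sgD sgA addbb /= opprD; congr (_ - _).
  rewrite [RHS](morph_on_last (mull_morph z)); apply: on_lastE => v y _.
  by rewrite cats1 /dright on_last_rcons mulrA.
have rr' : dright (fun t => sg (odd (size t)) (dright f t)) s = - sg (odd (size s))
  (dright (dright f) s).
  case/lastP: s {rr} => [|t z]; first by rewrite /dright /= oppr0.
  by rewrite {1}/dright /dright !on_last_rcons size_rcons /= sgNb opprK (morph_sg
    (mull_morph z)).
rewrite -[LHS]/(dleft (hdiff f) s + dmid (hdiff f) s + sg (odd (size s))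
  (dright (hdiff f) s)).
rewrite (_ : hdiff f = fun t => (dleft f t + dmid f t) + sg (odd (size t))
  (dright f t)); last first.
  by apply/funext.
rewrite !lamD !rhoD !dmidD dmid_dmid lr' br rr rr' lr !sgD !sgN !sgA addbb.
by have /eqP := ll s; rewrite -addrA addr_eq0 => /eqP ->; abel.
Qed.

Lemma insert_lin_r (W : lmodType k) c g g' a (Phi : seq A -> W) s : mlinear Phi ->
  insert c (fun t => a *: g t + g' t) Phi s = a *: insert c g Phi s + insert c g' Phi s.
Proof.
elim: s Phi => [|x s IH] Phi mP; rewrite /insert !slide_head.
  by rewrite /ins_front /ssum /= !addr0 (mP _ _ _ [::]).
rewrite /= -![slide c (ins_front _) _ s]/(insert c _ _ s) IH; last exact: mlinear_cons.
rewrite sgD sgZ scalerDr [RHS]addrACA; congr (_ + _).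
rewrite /ins_front (morph_ssum (scalerDr a)) -ssumD; apply: eq_ssum => u v _.
exact: (mP _ _ _ [::]).
Qed.

Lemma brace_lin_mid (W : lmodType k) c e h g g' a (Phi : seq A -> W) s : mlinear Phi ->
  brace c (fun t => a *: g t + g' t) e h Phi s =
  a *: brace c g e h Phi s + brace c g' e h Phi s.
Proof.
elim: s Phi => [|x s IH] Phi mP; rewrite /brace !slide_head.
  by rewrite /ins2_front /ssum /= !addr0 insert_front_lin.
rewrite /= -![slide _ (ins2_front _ _ _) _ s]/(brace c _ e h _ s) IH;
  last exact: mlinear_cons.
rewrite sgD sgZ scalerDr [RHS]addrACA; congr (_ + _).
rewrite /ins2_front (morph_ssum (scalerDr a)) -ssumD; apply: eq_ssum => u v _.
exact: insert_front_lin.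
Qed.

Lemma brace_lin_r (W : lmodType k) c g e h h' a (Phi : seq A -> W) s : mlinear Phi ->
  brace c g e (fun t => a *: h t + h' t) Phi s =
  a *: brace c g e h Phi s + brace c g e h' Phi s.
Proof.
have E Psi r : mlinear Psi -> ins2_front g e (fun t => a *: h t + h' t) Psi r =
    a *: ins2_front g e h Psi r + ins2_front g e h' Psi r.
  move=> mPsi; rewrite /ins2_front (morph_ssum (scalerDr a)) -ssumD;
    apply: eq_ssum => u v _.
  by apply: insert_lin_r; exact: mlinear_cons.
elim: s Phi => [|x s IH] Phi mP; rewrite /brace !slide_head.
  by rewrite E //= !addr0.
rewrite E //= -![slide _ (ins2_front _ _ _) _ s]/(brace c _ e _ _ s) IH;
  last exact: mlinear_cons.
by rewrite sgD sgZ [X in _ = X + _]scalerDr [RHS]addrACA.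
Qed.

Section CycIns.
Variable W : lmodType k.
Implicit Type Phi : seq A -> W.

Lemma mlinear_sg (p : nat -> bool) Phi : mlinear Phi ->
  mlinear (fun t => sg (p (size t)) (Phi t)).
Proof.
by move=> mP a x y s1 s2; rewrite mP !size_cat /= sgD sgZ.
Qed.

Lemma vanish1_sg (p : nat -> bool) Phi : vanish1 Phi ->
  vanish1 (fun t => sg (p (size t)) (Phi t)).
Proof. by move=> nP s1 s2; rewrite nP sg0. Qed.

Lemma vanish1_mid Phi u x : vanish1 Phi -> vanish1 (fun r => Phi (u ++ x :: r)).
Proof. by move=> nP s1 s2; rewrite -cat_cons catA nP. Qed.

Lemma vanish1_left Phi r : vanish1 Phi -> vanish1 (fun u => Phi (u ++ r)).
Proof. by move=> nP s1 s2; rewrite -catA cat_cons nP. Qed.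

Lemma cyc_insert_mlinear c g Phi x : mlinear g -> mlinear Phi ->
  mlinear (cyc_insert c g Phi x).
Proof.
move=> mg mP; apply: ssum_mlinear => [u|t].
  apply: (mlinear_sg (fun n => odd (size u) && ~~ odd n)).
  apply: (mlinear_sg (fun=> c && ~~ odd (size u))).
  by apply: insert_mlinear => //; exact: mlinear_mid.
apply: (mlinear_sg (fun n => odd n && ~~ odd (size t))).
apply: (mlinear_sg (fun n => c && ~~ odd n)).
move=> a y z s1 s2; rewrite -insert_lin; congr (insert _ _ _ _).
by apply/funext=> r; rewrite (mlinear_left (x :: r) mP).
Qed.

Lemma cyc_insert_vanish1 c g Phi x : vanish1 g -> mlinear Phi -> vanish1 Phi ->
  vanish1 (cyc_insert c g Phi x).
Proof.
move=> ng mP nP; apply: ssum_vanish1 => [u|t].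
  apply: (vanish1_sg (fun n => odd (size u) && ~~ odd n)).
  apply: (vanish1_sg (fun=> c && ~~ odd (size u))).
  by apply: insert_vanish1 => //; [exact: mlinear_mid | exact: vanish1_mid].
apply: (vanish1_sg (fun n => odd n && ~~ odd (size t))).
apply: (vanish1_sg (fun n => c && ~~ odd n)).
move=> s1 s2; rewrite (_ : (fun r => _) = fun=> 0) ?(linQ0 _ (insert_lin c g)) //.
by apply/funext=> r; rewrite (vanish1_left (x :: r) nP).
Qed.

Lemma cyc_insert_supported c g Phi x (D E F : nat -> Prop) : supported E g -> mlinear Phi ->
  (forall i j, D (i + 2)%N -> E j -> F (i + j)%N) ->
  supported D Phi -> supported F (cyc_insert c g Phi x).
Proof.
move=> sg mP DEF sP s /ssum_neq0 [t [u [-> ne]]]; rewrite size_cat.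
have ne2 : insert c g (fun r => Phi (u ++ x :: r)) t != 0.
  by apply: contraNneq ne => ->; rewrite !sg0.
apply: (insert_supported (D := fun n => D (size u + n.+1)%N)
  (F := fun n => F (n + size u)%N) sg (mlinear_mid u x mP) _ _ ne2).
  move=> i j Di Ej; rewrite addnAC; apply: DEF => //.
  by move: Di; rewrite addn1 !addnS addn0 addnC.
by move=> r /sP; rewrite size_cat.
Qed.

Lemma cyc_insert_arg_lin c g Phi a x y s : mlinear Phi ->
  cyc_insert c g Phi (a *: x + y) s = a *: cyc_insert c g Phi x s + cyc_insert c g Phi y s.
Proof.
move=> mP; rewrite /cyc_insert /cyclic_sum (morph_ssum (scalerDr a)) -ssumD.
apply: eq_ssum => t u _; rewrite -!sgZ -!sgD -insert_lin;
  congr (sg _ (sg _ (insert _ _ _ _))).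
by apply/funext=> r; rewrite mP.
Qed.

Lemma cyc_insert_lin_r c g g' a Phi x s : mlinear Phi ->
  cyc_insert c (fun t => a *: g t + g' t) Phi x s =
  a *: cyc_insert c g Phi x s + cyc_insert c g' Phi x s.
Proof.
move=> mP; rewrite /cyc_insert /cyclic_sum (morph_ssum (scalerDr a)) -ssumD.
apply: eq_ssum => t u _; rewrite insert_lin_r; last exact: mlinear_mid.
by rewrite !sgD !sgZ.
Qed.

End CycIns.

(** * Agreement with the indexed sums that define the operations *)

Lemma hochschild_hdiff f s : hochschild f s = hdiff f s.
Proof.
have bbE Phi t : \sum_(1 <= i < size t) (-1) ^+ i *: Phi (contract i t) = dmid Phi t :> A.
  elim: t Phi => [|x t IH] Phi; first by rewrite big_geq.
  rewrite dmid_cons -IH; case: t IH => [|y t] IH;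
    first by rewrite /= !big_geq // oppr0 addr0.
  rewrite /= big_ltn // expr1 scaleN1r; congr (- Phi _ + _).
    by rewrite /contract /= drop0.
  rewrite big_add1 -sumrN; apply: eq_big_nat => i /andP[i_gt0 lt_i].
  by rewrite exprS mulN1r scaleNr; congr (- (_ *: Phi _)); case: i i_gt0 {lt_i}.
case/lastP: s => [|s x]; first by rewrite /hdiff /dleft /dright /= !addr0.
rewrite (hochschildE f (size_rcons s x)) -{1 2}(size_rcons s x) bbE sg_odd.
have -> : (rcons s x)`_(size s) = x by rewrite nth_rcons ltnn eqxx.
have -> : take (size s) (rcons s x) = s by rewrite -cats1 take_size_cat.
rewrite /hdiff /dright on_last_rcons.
by congr (_ + _ + _); rewrite /dleft; case: s.
Qed.

Lemma big_ssum (W : zmodType) (F : seq A -> seq A -> W) s :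
  \sum_(i < (size s).+1) F (take i s) (drop i s) = ssum F s.
Proof.
elim: s F => [|x s IH] F; first by rewrite big_ord_recl big_ord0.
by rewrite big_ord_recl ssum_cons -IH.
Qed.

Lemma cupf_cup f g s : cupf f g s = cup f g s.
Proof. exact: big_ssum. Qed.

(** For [s = t ++ u] the rotation sign has exponent [|u| (|u| + |t|)], which is odd when [|u|] is
    odd and [|t|] is even. The index is reversed because rotations are counted by [|u|] and
    splittings by [|t|]. *)
Lemma cyclic_norm_cyc f x s : cyclic_norm f (x :: s) = cyc f x s.
Proof.
rewrite /cyclic_norm (reindex_inj rev_ord_inj) /= /cyc /cyclic_sum -big_ssum.
apply: eq_bigr => i _; have le_i : (i <= size s)%N by rewrite -ltnS.
rewrite sg_odd subSS size_takel // size_drop /rotr /rot.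
have -> : (size (x :: s) - (size s - i))%N = i.+1 by rewrite /=; lia.
rewrite -[in X in odd (_ * X)](subnK le_i) oddM oddD; congr (sg _ (f _)).
by case: odd; case: odd.
Qed.

End Raw.

Lemma linear_morph (k : fieldType) (V W : lmodType k) (F : V -> W) :
  linear F -> {morph F : x y / x + y}.
Proof. by move=> lF x y; have := lF 1 x y; rewrite !scale1r. Qed.

(** * The seven-term relation *)

(* [insr c f g] stands for the Gerstenhaber product [f o g], [br c e f g h] for the
   brace [f{g, h}], [homC] for the homotopy commutativity of [mul], and [homK] for
   the homotopy between the bracket and the deviation of [Del] from a derivation. *)
Section SevenTerm.
Variables (k : fieldType) (V : lmodType k) (parity : bool -> V -> Prop) (d Del : V ->
  V) (mul : V -> V -> V).
Variables (insr : bool -> V -> V -> V) (br : bool -> bool -> V -> V -> V -> V).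
Variables (homC homK : bool -> bool -> V -> V -> V).
Implicit Types (x y z b c e : bool) (f g h : V).

Hypothesis parity_Del : forall b f, parity b f -> parity (~~ b) (Del f).
Hypothesis parity_mul : forall b b' f g, parity b f -> parity b' g ->
  parity (b (+) b') (mul f g).
Hypothesis parity_homK : forall b b' f g,
  parity b f -> parity b' g -> parity (b (+) b') (homK b b' f g).

Hypothesis dL : linear d.
Hypothesis DelL : linear Del.
Hypothesis mulLl : forall g, linear (fun f => mul f g).
Hypothesis mulLr : forall f, linear (mul f).
Hypothesis brL1 : forall c e g h, linear (fun f => br c e f g h).
Hypothesis brL2 : forall c e f h, linear (fun g => br c e f g h).
Hypothesis brL3 : forall c e f g, linear (br c e f g).
Hypothesis homCLl : forall b b' g, linear (fun f => homC b b' f g).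
Hypothesis homCLr : forall b b' f, linear (homC b b' f).
Hypothesis homKLl : forall b b' g, linear (fun f => homK b b' f g).
Hypothesis homKLr : forall b b' f, linear (homK b b' f).

Hypothesis mulA : forall f g h, mul (mul f g) h = mul f (mul g h).
Hypothesis Del_d : forall f, Del (d f) = - d (Del f).
Hypothesis d_mul : forall b f g, parity b f ->
  d (mul f g) = mul (d f) g + sg b (mul f (d g)).
Hypothesis insr_mul : forall b c f g h, parity b f ->
  insr c (mul f g) h = mul (insr c f h) g + sg (c && b) (mul f (insr c g h)).
Hypothesis d_br : forall b c e f g h, parity b f -> parity (~~ c) g -> parity (~~ e) h ->
  d (br c e f g h) =
    sg (c (+) e) (br c e (d f) g h - mul g (insr e f h)
      - sg e (br c (~~ e) f g (d h)) + insr (~~ (c (+) e)) f (mul g h)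
      - sg (~~ b && ~~ e) (mul (insr c f g) h))
    + br (~~ c) e f (d g) h.
Hypothesis d_homC : forall b b' f g, parity b f -> parity b' g ->
  d (homC b b' f g) = mul f g - sg (b && b') (mul g f)
    - homC (~~ b) b' (d f) g - sg b (homC b (~~ b') f (d g)).
Hypothesis d_homK : forall b b' f g, parity b f -> parity b' g ->
  d (homK b b' f g) =
    (sg (~~ b' (+) (b && b')) (insr (~~ b') f g) + sg (~~ b) (insr (~~ b) g f))
    - Del (mul f g) - sg (~~ b' (+) (b && b')) (mul g (Del f)) - sg (~~ b) (mul f (Del g))
    + homK (~~ b) b' (d f) g + sg b (homK b (~~ b') f (d g)).

(* [homK] replaces the deviation of [Del] at [(f g, h)] by the bracket
   [{f g, h}], which is split by [insr_mul] and [br]; the resulting brackets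
   [{g, h}] and [{f, h}] are replaced by means of [homK] again. The terms [homC]
   put the factors into the right order. *)
Definition hom7 x y z f g h : V :=
  - homK (x (+) y) z (mul f g) h
  - br (~~ x) (~~ y) h f g
  + mul f (homK y z g h)
  + sg (y && z) (mul (homK x z f h) g)
  + sg (z && ~~ (x (+) y)) (homC z (~~ (x (+) y)) h (Del (mul f g)))
  - sg (z && ~~ y) (mul f (homC z (~~ y) h (Del g)))
  + sg (y && z) (homC (~~ (x (+) z)) y (Del (mul f h)) g)
  - sg ((y && z) (+) (z && ~~ x)) (homC z (~~ x (+) y) h (mul (Del f) g))
  - sg (y && z) (mul f (homC (~~ z) y (Del h) g)).

(** Purely formal: for each of the eight choices of parities, the hypotheses on [d] and the
    derivation rule [insr_mul] reduce both sides to the same signed sum of composites, once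
    associativity is used. *)
Lemma d_hom7 x y z f g h : parity x f -> parity y g -> parity z h ->
  Del (mul (mul f g) h)
  - (mul (Del (mul f g)) h + sg x (mul f (Del (mul g h)))
     + sg (~~ x && y) (mul g (Del (mul f h))) - mul (mul (Del f) g) h
     - sg x (mul (mul f (Del g)) h) - sg (x (+) y) (mul (mul f g) (Del h))) =
  d (hom7 x y z f g h)
  - (hom7 (~~ x) y z (d f) g h + sg x (hom7 x (~~ y) z f (d g) h)
     + sg (x (+) y) (hom7 x y (~~ z) f g (d h))).
Proof.
move=> pf pg ph.
(* Insertions are indexed by the parity of the degree minus one, hence the double negations. *)
have pf' : parity (~~ ~~ x) f by rewrite negbK.
have pg' : parity (~~ ~~ y) g by rewrite negbK.
have dD := linear_morph dL; have DelD := linear_morph DelL.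
have mulDl q := linear_morph (mulLl q); have mulDr q := linear_morph (mulLr q).
have homCDl b b' q := linear_morph (homCLl b b' q).
have homCDr b b' q := linear_morph (homCLr b b' q).
have homKDl b b' q := linear_morph (homKLl b b' q).
have homKDr b b' q := linear_morph (homKLr b b' q).
have hN (F : V -> V) (FD : {morph F : f g / f + g}) q : F (- q) = - F q.
  exact: (morph_sg FD true).
have dN := hN _ dD; have DN := hN _ DelD.
have mulNl q := hN _ (mulDl q); have mulNr q := hN _ (mulDr q).
have CNl b b' q := hN _ (homCDl b b' q); have CNr b b' q := hN _ (homCDr b b' q).
have KNl b b' q := hN _ (homKDl b b' q); have KNr b b' q := hN _ (homKDr b b' q).
have dDel q : d (Del q) = - Del (d q) by rewrite Del_d opprK.
(* Only the occurrence under [d] is unfolded here: [d] has to be pushed inwards while the parities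
   needed by each rule are still available. *)
rewrite {1}/hom7 !(dD, dN, morph_sg dD).
rewrite (d_homK (parity_mul pf pg) ph) (d_br ph pf' pg').
rewrite !(d_mul _ pf) (d_homK pg ph).
rewrite (d_mul _ (parity_homK pf ph)) (d_homK pf ph).
rewrite (d_homC ph (parity_Del (parity_mul pf pg))).
rewrite (d_homC ph (parity_Del pg)).
rewrite (d_homC (parity_Del (parity_mul pf ph)) pg).
rewrite (d_homC ph (parity_mul (parity_Del pf) pg)).
rewrite (d_homC (parity_Del ph) pg).
rewrite !dDel !(d_mul _ pf) (d_mul _ (parity_Del pf)) !dDel.
rewrite !(insr_mul _ _ _ pf).
move: x y z {pf pg ph pf' pg'} => [] [] []; rewrite /hom7 /=.
all: rewrite ?(dN, DN, dD, DelD, mulNl, mulNr, mulDl, mulDr, CNl, CNr, homCDl, homCDr,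
  KNl, KNr, homKDl, homKDr, mulA).
all: abel.
Qed.

Lemma hom7_trilin x y z : trilin (hom7 x y z).
Proof.
have Dl a u v : Del (a *: u + v) = a *: Del u + Del v := DelL a u v.
have Ml q a u v : mul (a *: u + v) q = a *: mul u q + mul v q := mulLl q a u v.
have Mr q a u v : mul q (a *: u + v) = a *: mul q u + mul q v := mulLr q a u v.
have Cl b b' q a u v : homC b b' (a *: u + v) q = a *: homC b b' u q + homC b b' v q :=
  homCLl b b' q a u v.
have Cr b b' q a u v : homC b b' q (a *: u + v) = a *: homC b b' q u + homC b b' q v :=
  homCLr b b' q a u v.
have Kl b b' q a u v : homK b b' (a *: u + v) q = a *: homK b b' u q + homK b b' v q :=
  homKLl b b' q a u v.
have Kr b b' q a u v : homK b b' q (a *: u + v) = a *: homK b b' q u + homK b b' q v :=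
  homKLr b b' q a u v.
have B1 c e g h a u v : br c e (a *: u + v) g h = a *: br c e u g h + br c e v g h :=
  brL1 c e g h a u v.
have B2 c e f h a u v : br c e f (a *: u + v) h = a *: br c e f u h + br c e f v h :=
  brL2 c e f h a u v.
have B3 c e f g a u v : br c e f g (a *: u + v) = a *: br c e f g u + br c e f g v :=
  brL3 c e f g a u v.
split=> ? ? ? ? ?; rewrite /hom7 !(Ml, Mr, Dl, Cl, Cr, Kl, Kr, B1, B2, B3) !(sgD, sgZ);
  rewrite !(scalerDr, scalerN); abel.
Qed.

End SevenTerm.

(** * Normalized cochains *)

Section CH.
Variables (k : fieldType) (A : falgType k).
Implicit Types (s t u v w : seq A) (b c e : bool) (a : k).
Local Notation V := (CHbar A).
Implicit Types (f g h : V).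

Lemma CH_mlinear f : mlinear f. Proof. by case: f => F /= /CHpredP[]. Qed.
Lemma CH_vanish1 f : vanish1 f. Proof. by case: f => F /= /CHpredP[]. Qed.
Lemma CH_fin f : exists N, supported (fun n => n < N)%N f.
Proof.
case: f => F /= /CHpredP[_ _ [N FN]]; exists N => s; apply: contraNltn => le.
by rewrite FN.
Qed.

Lemma CH_mem (F : seq A -> A) N : mlinear F -> vanish1 F ->
  supported (fun n => n < N)%N F -> F \in CHpred (A := A).
Proof.
move=> mF nF sF; apply/CHpredP; split=> //; exists N => s le_s.
by apply/eqP; apply: contraTT le_s => /sF; rewrite ltnNge.
Qed.

Lemma CHbar_ext f g : (forall s, f s = g s) -> f = g.
Proof. by move=> E; apply/val_inj/funext. Qed.

Lemma CH_insert_subproof c f g : insert c g f \in CHpred (A := A).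
Proof.
have [[N fN] [M gM]] := (CH_fin f, CH_fin g).
apply: (@CH_mem _ (N + M)); [exact: insert_mlinear (CH_mlinear g) (CH_mlinear f) | | ].
  exact: insert_vanish1 (CH_vanish1 g) (CH_mlinear f) (CH_vanish1 f).
by apply: (insert_supported gM (CH_mlinear f)) fN => i j; lia.
Qed.
Definition CHins c f g : V := CHbar_of (CH_insert_subproof c f g).

Lemma CH_brace_subproof c e f g h : brace c g e h f \in CHpred (A := A).
Proof.
have [[N fN] [[M gM] [P hP]]] := (CH_fin f, (CH_fin g, CH_fin h)).
apply: (@CH_mem _ (N + (M + P))); [exact:
  brace_mlinear (CH_mlinear g) (CH_mlinear h) (CH_mlinear f) | | ].
  exact: brace_vanish1 (CH_vanish1 g) (CH_vanish1 h) (CH_mlinear f) (CH_vanish1 f).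
by apply: (brace_supported gM hP (CH_mlinear f)) fN => i j1 j2; lia.
Qed.
Definition CHbrace c e f g h : V := CHbar_of (CH_brace_subproof c e f g h).

Lemma CHcupE f g s : CHcup f g s = cup f g s. Proof. exact: cupf_cup. Qed.
Lemma CHdiffE f s : CHdiff f s = hdiff f s. Proof. exact: hochschild_hdiff. Qed.

Lemma CHcup_fun f g : CHcup f g = cup f g :> (seq A -> A).
Proof. by apply/funext=> s; exact: cupf_cup. Qed.
Lemma CHdiff_fun f : CHdiff f = hdiff f :> (seq A -> A).
Proof. by apply/funext=> s; exact: hochschild_hdiff. Qed.
Lemma CHsg_fun b f s : (sg b f) s = sg b (f s). Proof. by case: b. Qed.

(** * Transport along the bilinear form *)

Section Form.
Variable eta : {symmetric A}.
Hypothesis eta_nondegenerate : nondegenerate eta.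
Hypothesis eta_invariant : forall a b c : A, eta (a * b) c = eta a (b * c).

(** The trace of the Frobenius algebra: invariance turns [eta x y] into the trace of [x * y], and
    symmetry of [eta] becomes cyclicity of the trace. *)
Definition etatr (x : A) : k^o := eta 1 x.

Lemma etatrD : {morph etatr : x y / x + y}.
Proof. by move=> x y; rewrite /etatr linearDr. Qed.
Lemma etatrN x : etatr (- x) = - etatr x.
Proof. exact: (morph_sg etatrD true). Qed.
Lemma etatrZ a x : etatr (a *: x) = a *: etatr x.
Proof. by rewrite /etatr linearZr. Qed.
Lemma etaE x y : eta x y = etatr (x * y).
Proof. by rewrite /etatr -eta_invariant mul1r. Qed.
Lemma etatrC x y : etatr (x * y) = etatr (y * x).
Proof. by rewrite -!etaE hermC expr0 mul1r. Qed.

Lemma lker_eta_flat : lker (eta_flat eta) = 0%VS.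
Proof.
apply/eqP; rewrite -subv0 -(eqP eta_nondegenerate); apply/subvP => y.
rewrite memv_ker => /eqP y0; apply/mem_orthovP => x _; apply/eqP.
by rewrite herm_eq0C -eta_flatE y0 zero_lfunE.
Qed.

Lemma etatr_inj y z : (forall x, etatr (x * y) = etatr (x * z)) -> y = z.
Proof.
move=> E; have /lker0P := introT eqP lker_eta_flat; apply.
by apply/lfunP => x; rewrite !eta_flatE !etaE.
Qed.

(** The vector that represents the functional [phi] through [eta]; its defining property requires
    [phi] to be linear. *)
Definition riesz (phi : A -> k^o) : A := (eta_flat eta)^-1%VF (linfun phi).

Lemma rieszE (phi : A -> k^o) x :
  (forall a x y, phi (a *: x + y) = a *: phi x + phi y) -> etatr (x * riesz phi) = phi x.
Proof.
move=> lphi; rewrite -etaE -eta_flatE limg_lfunVK ?lin_funE //.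
suff -> : limg (eta_flat eta) = fullv by exact: memvf.
(* Nondegeneracy makes [eta_flat] injective; it is onto because the algebra and its dual have the
   same dimension. *)
apply/eqP; rewrite eqEdim subvf limg_dim_eq ?lker_eta_flat ?capv0 //.
by rewrite !dimvf /dim /= muln1.
Qed.

Definition cyc_cochain c f g : seq A -> A :=
  fun s => riesz (fun x => cyc_insert c g (fun t => etatr (f t)) x s).

Lemma cyc_cochainE c f g x s :
  etatr (x * cyc_cochain c f g s) = cyc_insert c g (fun t => etatr (f t)) x s.
Proof.
by apply: rieszE => a y z; apply/cyc_insert_arg_lin/(tr_mlinear etatrD etatrZ)/CH_mlinear.
Qed.

Lemma etatr_supported (D : nat -> Prop) (F : seq A -> A) :
  supported D F -> supported D (fun t => etatr (F t)).
Proof. by move=> sF s; move=> ne; apply: sF; apply: contraNneq ne => ->;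
  rewrite (morph0 etatrD). Qed.

(** Two arguments of [f] are not letters of [s], the distinguished letter and the output of [g];
    hence the shift by two. *)
Lemma cyc_cochain_supported c f g (D E F : nat -> Prop) : supported E g ->
  (forall i j, D (i + 2)%N -> E j -> F (i + j)%N) -> supported D f ->
    supported F (cyc_cochain c f g).
Proof.
move=> sg DEF sf s ne; have [x nx] : exists x, etatr (x * cyc_cochain c f g s) != 0.
  apply: contrapT => nex; case/eqP: ne; apply: etatr_inj => x.
  rewrite mulr0 (morph0 etatrD); apply/eqP; apply: contrapT => /negP nx.
  by apply: nex; exists x.
rewrite cyc_cochainE in nx.
exact: (cyc_insert_supported sg (tr_mlinear etatrD etatrZ (CH_mlinear f))
  DEF (etatr_supported sf) nx).
Qed.

Lemma CH_cyc_cochain_subproof c f g : cyc_cochain c f g \in CHpred (A := A).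
Proof.
have mf := tr_mlinear etatrD etatrZ (CH_mlinear f).
have [[N fN] [M gM]] := (CH_fin f, CH_fin g).
apply: (@CH_mem _ (N + M)).
- move=> a y z s1 s2; apply: etatr_inj => x.
  rewrite mulrDr -scalerAr etatrD etatrZ !cyc_cochainE.
  exact: cyc_insert_mlinear (CH_mlinear g) mf _ _ _ _ _.
- move=> s1 s2; apply: etatr_inj => x.
  rewrite cyc_cochainE mulr0 (morph0 etatrD);
    apply: cyc_insert_vanish1 (CH_vanish1 g) mf _ _ _.
  by move=> t1 t2; rewrite CH_vanish1 (morph0 etatrD).
by apply: (cyc_cochain_supported gM) fN => i j; lia.
Qed.
Definition CHcyc c f g : V := CHbar_of (CH_cyc_cochain_subproof c f g).

Local Notation d := (@CHdiff k A).
Local Notation mul := (@CHcup k A).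
Local Notation Del := (CHDelta eta).

Lemma DelE f x s : etatr (x * Del f s) = cyc (fun s => etatr (f s)) x s.
Proof.
rewrite -etaE CHDeltaE // cyclic_norm_cyc /cyc /cyclic_sum -/(etatr _).
by rewrite (morph_ssum etatrD); apply: eq_ssum => t u _; rewrite (morph_sg etatrD).
Qed.

Lemma d_lin : linear d.
Proof.
move=> a f g; apply: CHbar_ext => s; rewrite CHdiffE.
rewrite -[RHS]/(a *: d f s + d g s) !CHdiffE /hdiff !scalerDr.
rewrite -[CHfun (a *: f + g)]/(fun t => a *: f t + g t).
rewrite dmidD (dmid_morph _ _ (scalerDr a)).
have -> : dleft (fun t => a *: f t + g t) s = a *: dleft f s + dleft g s.
  rewrite /dleft (morph_on_head (scalerDr a)) -on_headD; apply: on_headE => x t _.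
  by rewrite mulrDr scalerAr.
have -> : dright (fun t => a *: f t + g t) s = a *: dright f s + dright g s.
  rewrite /dright (morph_on_last (scalerDr a)) -on_lastD; apply: on_lastE => t x _.
  by rewrite mulrDl scalerAl.
by rewrite sgD sgZ; abel.
Qed.

Lemma mul_lin_l g : linear (fun f => mul f g).
Proof.
move=> a f f'; apply: CHbar_ext => s.
rewrite -[RHS]/(a *: mul f g s + mul f' g s) !CHcupE /cup (morph_ssum (scalerDr a)) -ssumD.
by apply: eq_ssum => u v _; rewrite scalerAl -mulrDl.
Qed.

Lemma mul_lin_r f : linear (mul f).
Proof.
move=> a g g'; apply: CHbar_ext => s.
rewrite -[RHS]/(a *: mul f g s + mul f g' s) !CHcupE /cup (morph_ssum (scalerDr a)) -ssumD.
by apply: eq_ssum => u v _; rewrite scalerAr -mulrDr.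
Qed.

Lemma Del_lin : linear Del.
Proof.
move=> a f g; apply: CHbar_ext => s; apply: etatr_inj => x.
rewrite -[(_ + _ : V) s]/(a *: Del f s + Del g s) mulrDr -scalerAr etatrD etatrZ !DelE.
rewrite -(cyc_lin x); congr (cyc _ x s); apply/funext=> t.
by rewrite -etatrZ -etatrD.
Qed.

Lemma CHins_lin_l c g : linear (fun f => CHins c f g).
Proof. by move=> a f f'; apply: CHbar_ext => s; exact: insert_lin. Qed.

Lemma CHins_lin_r c f : linear (CHins c f).
Proof. by move=> a g g'; apply: CHbar_ext => s;
  exact: (insert_lin_r _ _ _ _ _ (CH_mlinear f)). Qed.

Lemma CHbrace_lin1 c e g h : linear (fun f => CHbrace c e f g h).
Proof. by move=> a f f'; apply: CHbar_ext => s; exact: brace_lin. Qed.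

Lemma CHbrace_lin2 c e f h : linear (fun g => CHbrace c e f g h).
Proof. by move=> a g g'; apply: CHbar_ext => s;
  exact: (brace_lin_mid _ _ _ _ _ _ _ (CH_mlinear f)). Qed.

Lemma CHbrace_lin3 c e f g : linear (CHbrace c e f g).
Proof. by move=> a h h'; apply: CHbar_ext => s;
  exact: (brace_lin_r _ _ _ _ _ _ _ (CH_mlinear f)). Qed.

Lemma CHcyc_lin_l c g : linear (fun f => CHcyc c f g).
Proof.
move=> a f f'; apply: CHbar_ext => s; apply: etatr_inj => x.
rewrite -[(_ + _ : V) s]/(a *: cyc_cochain c f g s + cyc_cochain c f' g s)
  mulrDr -scalerAr etatrD etatrZ !cyc_cochainE.
rewrite -(cyc_insert_lin c g x); congr (cyc_insert _ _ _ x s); apply/funext=> t.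
by rewrite -etatrZ -etatrD.
Qed.

Lemma CHcyc_lin_r c f : linear (CHcyc c f).
Proof.
move=> a g g'; apply: CHbar_ext => s; apply: etatr_inj => x.
rewrite -[(_ + _ : V) s]/(a *: cyc_cochain c f g s + cyc_cochain c f g' s)
  mulrDr -scalerAr etatrD etatrZ !cyc_cochainE.
exact: (cyc_insert_lin_r _ _ _ _ _ _ (tr_mlinear etatrD etatrZ (CH_mlinear f))).
Qed.

Lemma Del_supported (D E : nat -> Prop) f : (forall i, D i.+1 -> E i) ->
  supported D f -> supported E (Del f).
Proof.
move=> DE sf s ne; have [x] : exists x, etatr (x * Del f s) != 0.
  apply: contrapT => nex; case/eqP: ne; apply: etatr_inj => x.
  rewrite mulr0 (morph0 etatrD); apply/eqP; apply: contrapT => /negP nx.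
  by apply: nex; exists x.
rewrite DelE => /ssum_neq0 [t [u [-> ne']]]; apply: DE.
have /sf : f (u ++ x :: t) != 0.
  by apply: contraNneq ne' => ->; rewrite (morph0 etatrD) sg0.
by rewrite !size_cat /= addnS addnC.
Qed.

Lemma d_mul b f g : parity b f -> d (mul f g) = mul (d f) g + sg b (mul f (d g)).
Proof.
move=> pf; apply: CHbar_ext => s.
rewrite -[RHS]/(mul (d f) g s + sg b (mul f (d g)) s) CHsg_fun.
by rewrite !(CHdiffE, CHcupE) CHcup_fun !CHdiff_fun (hdiff_cup _ _ pf).
Qed.

Lemma CHcup_assoc f g h : mul (mul f g) h = mul f (mul g h).
Proof.
apply: CHbar_ext => s; rewrite !CHcupE !CHcup_fun.
transitivity (ssum (fun t w => ssum (fun u v => f u * (g v * h w)) t) s).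
  apply: eq_ssum => t w _; rewrite [LHS](morph_ssum (mull_morph (h w))).
  by apply: eq_ssum => u v _; rewrite mulrA.
rewrite -ssum_assoc; apply: eq_ssum => u v _.
by rewrite (morph_ssum (mulr_morph (f u))).
Qed.

Lemma d_d f : d (d f) = 0.
Proof. by apply: CHbar_ext => s; rewrite CHdiffE CHdiff_fun hdiff_hdiff. Qed.

Lemma Del_d f : Del (d f) = - d (Del f).
Proof.
apply: CHbar_ext => s; apply: etatr_inj => x.
rewrite -[(- _ : V) s]/(- d (Del f) s) mulrN etatrN DelE CHdiffE.
rewrite CHdiff_fun (cyc_hdiff etatrD etatrC) -(dcyc_tr etatrD etatrC); congr (- dcyc _ x s).
by apply/funext=> y; apply/funext=> t; rewrite DelE.
Qed.

Lemma Del_Del f : Del (Del f) = 0.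
Proof.
apply: CHbar_ext => s; apply: etatr_inj => x; rewrite mulr0 (morph0 etatrD) DelE.
rewrite /cyc /cyclic_sum ssum0 // => t u _.
rewrite -[Del f _]mul1r DelE [cyc _ _ _]ssum0 ?sg0 // => v w _.
by rewrite CH_vanish1 (morph0 etatrD) sg0.
Qed.

Lemma parity_Del b f : parity b f -> parity (~~ b) (Del f).
Proof. by apply: Del_supported => i <-; rewrite /= negbK. Qed.
Lemma parity_mul b b' f g : parity b f -> parity b' g -> parity (b (+) b') (mul f g).
Proof. by rewrite CHcup_fun; exact: cup_parity. Qed.

(** The sign gives [mul f g] the coefficient 1 in [d_homC]. *)
Definition homC b b' f g : V := sg ((b && b') (+) ~~ b') (CHins (~~ b') f g).

Lemma CHins_d b c f g : parity b f -> parity (~~ c) g ->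
  CHins c (d f) g = sg c (d (CHins c f g)) - sg c (CHins (~~ c) f (d g))
    + mul g f - sg (b && ~~ c) (mul f g).
Proof.
move=> pf pg; apply: CHbar_ext => s; have := insert_hdiff s (CH_mlinear f) pg pf.
rewrite -!CHdiff_fun -!CHcupE -[insert c g f]/(CHfun (CHins c f g)) -CHdiffE.
move=> E; rewrite [LHS]E.
by case: (c); case: (b).
Qed.

Lemma d_homC b b' f g : parity b f -> parity b' g ->
  d (homC b b' f g) = mul f g - sg (b && b') (mul g f)
    - homC (~~ b) b' (d f) g - sg b (homC b (~~ b') f (d g)).
Proof.
move=> pf pg; have pg' : parity (~~ ~~ b') g by rewrite negbK.
rewrite /homC (CHins_d pf pg') (morph_sg (linear_morph d_lin)).
by case: (b); case: (b'); rewrite /=; abel.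
Qed.

Lemma CHins_mul b c f g h : parity b f ->
  CHins c (mul f g) h = mul (CHins c f h) g + sg (c && b) (mul f (CHins c g h)).
Proof.
move=> pf; apply: CHbar_ext => s.
rewrite -[RHS]/(mul (CHins c f h) g s + sg (c && b) (mul f (CHins c g h)) s).
by rewrite CHsg_fun !CHcupE -(insert_cup _ _ _ _ pf) -CHcup_fun.
Qed.

Lemma d_brace b c e f g h : parity b f -> parity (~~ c) g -> parity (~~ e) h ->
  d (CHbrace c e f g h) =
    sg (c (+) e) (CHbrace c e (d f) g h - mul g (CHins e f h)
      - sg e (CHbrace c (~~ e) f g (d h)) + CHins (~~ (c (+) e)) f (mul g h)
      - sg (~~ b && ~~ e) (mul (CHins c f g) h))
    + CHbrace (~~ c) e f (d g) h.
Proof.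
move=> pf pg ph; have -> : CHbrace c e (d f) g h =
    mul g (CHins e f h) + sg (c (+) e) (d (CHbrace c e f g h))
    - sg (c (+) e) (CHbrace (~~ c) e f (d g) h)
    + sg e (CHbrace c (~~ e) f g (d h))
    - CHins (~~ (c (+) e)) f (mul g h)
    + sg (~~ b && ~~ e) (mul (CHins c f g) h).
  apply: CHbar_ext => s; have := brace_hdiff s (CH_mlinear f) pg ph pf.
  rewrite -!CHdiff_fun -[insert e h f]/(CHfun (CHins e f h)).
  rewrite -[insert c g f]/(CHfun (CHins c f g)) -!CHcupE -CHcup_fun.
  rewrite -[brace c g e h f]/(CHfun (CHbrace c e f g h)) -CHdiffE => E; rewrite [LHS]E.
  by case: (c); case: (e); case: (b).
by case: (c); case: (e); case: (b); rewrite /=; abel.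
Qed.

(** One summand for each half of [cyc_cup]. The sign [sg (b && b')] in front of the second half
    cancels the same factor in its own sign, whence the asymmetric form. *)
Definition homK b b' f g : V :=
  sg (~~ b' (+) (b && b')) (CHcyc (~~ b') f g) + sg (~~ b) (CHcyc (~~ b) g f).

(** The Gerstenhaber bracket up to a global sign: the relative sign of the two products is minus the
    Koszul sign of the degrees lowered by one. *)
Definition brack b b' f g : V :=
  sg (~~ b' (+) (b && b')) (CHins (~~ b') f g) + sg (~~ b) (CHins (~~ b) g f).

(** [dcyc_insert_tr] solved for its cup term, with the functionals turned back into cochains. *)
Lemma cyc_cup_half_cyc_cochain b b' f g x s : parity b f -> parity b' g ->
  cyc_cup_half etatr f g x s = etatr (x * sg (~~ b' (+) (b && b')) (CHins (~~ b') f g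
    - mul g (Del f) - d (CHcyc (~~ b') f g) - sg (~~ b') (CHcyc (~~ b') (d f) g)
    - CHcyc b' f (d g)) s).
Proof.
move=> pf pg; have pg' : parity (~~ ~~ b') g by rewrite negbK.
have := dcyc_insert_tr etatrD etatrZ etatrC x s (CH_mlinear f) pf pg' (DelE f).
rewrite -!CHdiff_fun negbK.
rewrite [dcyc _ x s](_ : _ = etatr (x * d (CHcyc (~~ b') f g) s)); last first.
  rewrite CHdiffE -(dcyc_tr etatrD etatrC); congr (dcyc _ x s).
  by apply/funext=> y; apply/funext=> t; rewrite cyc_cochainE.
rewrite -!cyc_cochainE -CHcupE => E.
pose T (X : V) := etatr (x * X s).
have TD : {morph T : X Y / X + Y} by move=> X Y; rewrite /T -etatrD -mulrDr.
have TN X : T (- X) = - T X := morph_sg TD true X.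
rewrite -[RHS]/(T _) (morph_sg TD) !(TD, TN) (morph_sg TD) /T E.
by case: (b); case: (b'); rewrite /=; abel.
Qed.

Lemma d_homK b b' f g : parity b f -> parity b' g ->
  d (homK b b' f g) = brack b b' f g - Del (mul f g)
    - sg (~~ b' (+) (b && b')) (mul g (Del f)) - sg (~~ b) (mul f (Del g))
    + homK (~~ b) b' (d f) g + sg b (homK b (~~ b') f (d g)).
Proof.
move=> pf pg; have -> : Del (mul f g) =
    sg (~~ b' (+) (b && b')) (CHins (~~ b') f g
    - mul g (Del f) - d (CHcyc (~~ b') f g) - sg (~~ b') (CHcyc (~~ b') (d f) g)
    - CHcyc b' f (d g)) +
    sg (~~ b) (CHins (~~ b) g f
    - mul f (Del g) - d (CHcyc (~~ b) g f) - sg (~~ b) (CHcyc (~~ b) (d g) f)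
    - CHcyc b g (d f)).
  apply: CHbar_ext => s; apply: etatr_inj => x.
  rewrite DelE CHcup_fun (cyc_cup etatrD etatrC _ _ pf pg)
    (cyc_cup_half_cyc_cochain _ _ pf pg) (cyc_cup_half_cyc_cochain _ _ pg pf).
  pose T (X : V) := etatr (x * X s).
  have TD : {morph T : X Y / X + Y} by move=> X Y; rewrite /T -etatrD -mulrDr.
  rewrite -[RHS]/(T _) TD -[etatr (x * _) in LHS]/(T _) -[sg (b && b') _]/(sg (b && b')
    (T _)).
  rewrite -(morph_sg TD) sgA; congr (_ + T (sg _ _)).
  by case: (b); case: (b').
rewrite /homK /brack (linear_morph d_lin) !(morph_sg (linear_morph d_lin)).
by case: (b); case: (b'); rewrite /=; abel.
Qed.

Lemma homK_lin_l b b' g : linear (fun f => homK b b' f g).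
Proof.
move=> a f f'; rewrite /homK.
rewrite (CHcyc_lin_l _ _ a f f') (CHcyc_lin_r _ _ a f f') !sgD !sgZ scalerDr.
by abel.
Qed.

Lemma homK_lin_r b b' f : linear (homK b b' f).
Proof.
move=> a g g'; rewrite /homK.
rewrite (CHcyc_lin_l _ _ a g g') (CHcyc_lin_r _ _ a g g') !sgD !sgZ scalerDr.
by abel.
Qed.

Lemma homC_lin_l b b' g : linear (fun f => homC b b' f g).
Proof. by move=> a f f'; rewrite /homC (CHins_lin_l _ _ a f f') sgD sgZ. Qed.

Lemma homC_lin_r b b' f : linear (homC b b' f).
Proof. by move=> a g g'; rewrite /homC (CHins_lin_r _ _ a g g') sgD sgZ. Qed.

Lemma CHsg_parity b b' f : parity b f -> parity b (sg b' f).
Proof.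
by move=> pf s; rewrite CHsg_fun => ne; apply: pf; apply: contraNneq ne => ->; rewrite sg0.
Qed.

Lemma CHD_parity b f g : parity b f -> parity b g -> parity b (f + g : V).
Proof.
move=> pf pg s; have [f0|/pf //] := eqVneq (f s) 0; have [g0|/pg //] := eqVneq (g s) 0.
by rewrite -[(f + g : V) s]/(f s + g s) f0 g0 addr0 eqxx.
Qed.

Lemma cyc_cochain_parity b b' c f g : parity b f -> parity b' g ->
  parity (b (+) b') (CHcyc c f g).
Proof.
move=> pf pg; apply: (cyc_cochain_supported pg) pf => i j <- <-.
by rewrite !oddD addbF.
Qed.

Lemma homK_parity b b' f g : parity b f -> parity b' g -> parity (b (+) b') (homK b b' f g).
Proof.
move=> pf pg; apply: CHD_parity; apply: CHsg_parity; first exact: cyc_cochain_parity.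
by rewrite addbC; exact: cyc_cochain_parity.
Qed.

Definition CHhom7 x y z := hom7 Del mul CHbrace homC homK x y z.

Lemma d_CHhom7 x y z f g h : parity x f -> parity y g -> parity z h ->
  Del (mul (mul f g) h)
  - (mul (Del (mul f g)) h + sg x (mul f (Del (mul g h)))
     + sg (~~ x && y) (mul g (Del (mul f h))) - mul (mul (Del f) g) h
     - sg x (mul (mul f (Del g)) h) - sg (x (+) y) (mul (mul f g) (Del h))) =
  d (CHhom7 x y z f g h)
  - (CHhom7 (~~ x) y z (d f) g h + sg x (CHhom7 x (~~ y) z f (d g) h)
     + sg (x (+) y) (CHhom7 x y (~~ z) f g (d h))).
Proof.
apply: (d_hom7 (parity := fun b (f : V) => parity b f) (insr := CHins)) => //.
- exact: (parity_Del).
- exact: parity_mul.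
- exact: homK_parity.
- exact: d_lin.
- exact: Del_lin.
- exact: mul_lin_l.
- exact: mul_lin_r.
- exact: homC_lin_l.
- exact: homC_lin_r.
- exact: homK_lin_l.
- exact: homK_lin_r.
- exact: CHcup_assoc.
- exact: Del_d.
- exact: d_mul.
- by move=> *; exact: CHins_mul.
- by move=> *; exact: d_brace.
- by move=> *; exact: d_homC.
- exact: (d_homK).
Qed.

(** * Degrees and their parities *)

Definition oddz (n : int) : bool := odd `|n|%N.

Lemma oddzD n m : oddz (n + m) = oddz n (+) oddz m.
Proof. by rewrite /oddz; lia. Qed.

Lemma oddzM n m : oddz (n * m) = oddz n && oddz m.
Proof. by rewrite /oddz abszM oddM. Qed.

Lemma signz_sg (n : int) (v : V) : (-1) ^ n *: v = sg (oddz n) v.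
Proof.
case: n => n; first exact: sg_odd.
by rewrite NegzE -exprnN -exprVn invrN1 /oddz abszN sg_odd.
Qed.

Lemma CHdegE n f : CHdeg n f <-> supported (fun i => i%:Z = n) f.
Proof.
split=> [df s ne|sf s ne]; first by apply/eqP; apply: contraNT ne => /df ->.
by apply/eqP; apply: contraNT ne => /sf ->.
Qed.

Lemma deg_parity n f : CHdeg n f -> parity (oddz n) f.
Proof. by move/CHdegE => sf s /sf <-. Qed.

Lemma deg_mul n m f g : CHdeg n f -> CHdeg m g -> CHdeg (n + m) (mul f g).
Proof.
rewrite !CHdegE CHcup_fun => sf sg; apply: (cup_supported _ sf sg) => i j; lia.
Qed.

Lemma deg_d n f : CHdeg n f -> CHdeg (n + 1) (d f).
Proof. by rewrite !CHdegE CHdiff_fun; apply: hdiff_supported => i; lia. Qed.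

Lemma deg_Del n f : CHdeg n f -> CHdeg (n - 1) (Del f).
Proof. by rewrite !CHdegE; apply: Del_supported => // i; lia. Qed.

Lemma deg_D n f g : CHdeg n f -> CHdeg n g -> CHdeg n (f + g : V).
Proof. by move=> df dg s ne; rewrite -[(f + g : V) s]/(f s + g s) df // dg // addr0. Qed.

Lemma deg_sg n b f : CHdeg n f -> CHdeg n (sg b f : V).
Proof. by move=> df s ne; rewrite CHsg_fun df // sg0. Qed.

Lemma deg_N n f : CHdeg n f -> CHdeg n (- f : V).
Proof. exact: (deg_sg true). Qed.

Lemma deg_homC n m b b' f g : CHdeg n f -> CHdeg m g -> CHdeg (n + m - 1) (homC b b' f g).
Proof.
move=> df dg; apply: deg_sg; move: df dg; rewrite !CHdegE => df dg.
by apply: (insert_supported dg (CH_mlinear f)) df => i j; lia.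
Qed.

Lemma deg_cyc_cochain n m c f g : CHdeg n f -> CHdeg m g -> CHdeg (n + m - 2) (CHcyc c f g).
Proof.
rewrite !CHdegE => df dg; apply: (cyc_cochain_supported dg) df => i j; lia.
Qed.

Lemma deg_homK n m b b' f g : CHdeg n f -> CHdeg m g -> CHdeg (n + m - 2) (homK b b' f g).
Proof.
move=> df dg; apply: deg_D; apply: deg_sg; first exact: deg_cyc_cochain.
by rewrite (addrC n); exact: deg_cyc_cochain.
Qed.

Lemma deg_brace n m p c e f g h : CHdeg n f -> CHdeg m g -> CHdeg p h ->
  CHdeg (n + m + p - 2) (CHbrace c e f g h).
Proof.
rewrite !CHdegE => df dg dh; apply: (brace_supported dg dh (CH_mlinear f))
  df => i j1 j2; lia.
Qed.

Lemma deg_CHhom7 n m p x y z f g h : CHdeg n f -> CHdeg m g -> CHdeg p h ->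
  CHdeg (n + m + p + (-1 - 1)) (CHhom7 x y z f g h).
Proof.
move=> df dg dh; have cast q r q' : r = q -> CHdeg r q' -> CHdeg q q' by move=> ->.
rewrite /CHhom7 /hom7; repeat apply: deg_D; try apply: deg_N; try apply: deg_sg.
- by apply: cast (deg_homK _ _ (deg_mul df dg) dh); lia.
- by apply: cast (deg_brace _ _ dh df dg); lia.
- by apply: cast (deg_mul df (deg_homK _ _ dg dh)); lia.
- by apply: cast (deg_mul (deg_homK _ _ df dh) dg); lia.
- by apply: cast (deg_homC _ _ dh (deg_Del (deg_mul df dg))); lia.
- by apply: cast (deg_mul df (deg_homC _ _ dh (deg_Del dg))); lia.
- by apply: cast (deg_homC _ _ (deg_Del (deg_mul df dh)) dg); lia.
- by apply: cast (deg_homC _ _ dh (deg_mul (deg_Del df) dg)); lia.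
- by apply: cast (deg_mul df (deg_homC _ _ (deg_Del dh) dg)); lia.
Qed.

(** * Homotopies defined on all cochains, and the conclusion *)

Lemma parity_part_mem b f : (fun s => if odd (size s) == b then f s else 0)
  \in CHpred (A := A).
Proof.
have [N fN] := CH_fin f; apply: (@CH_mem _ N).
- move=> a x y s1 s2; rewrite !size_cat /= (CH_mlinear f).
  by case: ifP; rewrite ?scaler0 ?addr0.
- by move=> s1 s2; rewrite (CH_vanish1 f); case: ifP.
by move=> s; case: ifP => _; [exact: fN | rewrite eqxx].
Qed.

Definition parity_part b f : V := CHbar_of (parity_part_mem b f).

Lemma parity_part_lin b : linear (parity_part b).
Proof.
move=> a f g; apply: CHbar_ext => s.
rewrite -[(_ + _ : V) s]/(a *: parity_part b f s + parity_part b g s) /=.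
by case: ifP; rewrite ?scaler0 ?addr0.
Qed.

Lemma parity_partE n b f : CHdeg n f -> parity_part b f = if b == oddz n then f else 0.
Proof.
move=> /deg_parity pf; apply: CHbar_ext => s /=.
rewrite [RHS](_ : _ = if b == oddz n then f s else 0); last by case: (b == _).
by have [->|/pf ->] := eqVneq (f s) 0; [rewrite !if_same | rewrite eq_sym].
Qed.

Local Notation hom := (@CHdeg k A).

(* A parity-dependent family of operations extends off homogeneous elements by
   splitting each argument into its even and odd parts. *)
Lemma homotopic2_parity (e : int) Phi Psi (H : bool -> bool -> V -> V -> V) :
  (forall x y, bilin (H x y)) -> (forall x y, degree2 hom (e - 1) (H x y)) ->
  (forall n m f g, hom n f -> hom m g -> Phi n m f g - Psi n m f g =
    d (H (oddz n) (oddz m) f g) + sg (oddz e) (H (~~ oddz n) (oddz m) (d f) g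
      + sg (oddz n) (H (oddz n) (~~ oddz m) f (d g)))) ->
  homotopic2 hom d e Phi Psi.
Proof.
move=> Hl Hd HE.
pose T f g := \sum_(x : bool) \sum_(y : bool) H x y (parity_part x f) (parity_part y g).
have H0l x y g : H x y 0 g = 0 := morph0 (linear_morph ((Hl x y).1 g)).
have H0r x y f : H x y f 0 = 0 := morph0 (linear_morph ((Hl x y).2 f)).
have TE n m f g : hom n f -> hom m g -> T f g = H (oddz n) (oddz m) f g.
  move=> df dg; rewrite /T !big_bool /= !(parity_partE _ df) !(parity_partE _ dg).
  by case: (oddz n); case: (oddz m); rewrite /= ?H0l ?H0r ?addr0 ?add0r.
exists T; split.
- split=> [g|f] a x y; rewrite /T scaler_sumr -big_split; apply: eq_bigr => i _;
    rewrite scaler_sumr -big_split; apply: eq_bigr => j _ /=; rewrite parity_part_lin.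
    exact: (Hl i j).1.
  exact: (Hl i j).2.
- move=> n m f g df dg; rewrite (TE _ _ _ _ df dg); exact: (Hd _ _ _ _ _ _ df dg).
move=> n m f g df dg; have := HE _ _ _ _ df dg; rewrite !signz_sg.
rewrite (TE _ _ _ _ df dg) (TE _ _ _ _ (deg_d df) dg) (TE _ _ _ _ df (deg_d dg)).
by rewrite !oddzD !addbT.
Qed.

Lemma homotopic3_parity (e : int) Phi Psi (H : bool -> bool -> bool -> V -> V -> V -> V) :
  (forall x y z, trilin (H x y z)) -> (forall x y z, degree3 hom (e - 1) (H x y z)) ->
  (forall n m p f g h, hom n f -> hom m g -> hom p h ->
    Phi n m p f g h - Psi n m p f g h =
    d (H (oddz n) (oddz m) (oddz p) f g h) + sg (oddz e) (H (~~ oddz n) (oddz m)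
      (oddz p) (d f) g h
      + sg (oddz n) (H (oddz n) (~~ oddz m) (oddz p) f (d g) h)
      + sg (oddz n (+) oddz m) (H (oddz n) (oddz m) (~~ oddz p) f g (d h)))) ->
  homotopic3 hom d e Phi Psi.
Proof.
move=> Hl Hd HE.
pose T f g h := \sum_(x : bool) \sum_(y : bool) \sum_(z : bool)
  H x y z (parity_part x f) (parity_part y g) (parity_part z h).
have H1 x y z g h : H x y z 0 g h = 0.
  by case: (Hl x y z) => L _ _; exact: (morph0 (linear_morph (L g h))).
have H2 x y z f h : H x y z f 0 h = 0.
  by case: (Hl x y z) => _ L _; exact: (morph0 (linear_morph (L f h))).
have H3 x y z f g : H x y z f g 0 = 0.
  by case: (Hl x y z) => _ _ L; exact: (morph0 (linear_morph (L f g))).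
have TE n m p f g h : hom n f -> hom m g -> hom p h ->
    T f g h = H (oddz n) (oddz m) (oddz p) f g h.
  move=> df dg dh; rewrite /T !big_bool /= !(parity_partE _ df) !(parity_partE _ dg)
    !(parity_partE _ dh).
  by case: (oddz n); case: (oddz m); case: (oddz p); rewrite /= ?H1 ?H2 ?H3 ?addr0 ?add0r.
exists T; split.
- split=> [g h|f h|f g] a x y; rewrite /T scaler_sumr -big_split; apply: eq_bigr => i _;
    rewrite scaler_sumr -big_split; apply: eq_bigr => j _;
    rewrite scaler_sumr -big_split; apply: eq_bigr => l _ /=; rewrite parity_part_lin;
    by case: (Hl i j l) => L1 L2 L3; rewrite (L1, L2, L3).
- move=> n m p f g h df dg dh; rewrite (TE _ _ _ _ _ _ df dg dh);
  exact: (Hd _ _ _ _ _ _ _ _ _ df dg dh).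
move=> n m p f g h df dg dh; have := HE _ _ _ _ _ _ df dg dh; rewrite !signz_sg.
rewrite (TE _ _ _ _ _ _ df dg dh) (TE _ _ _ _ _ _ (deg_d df) dg dh).
rewrite (TE _ _ _ _ _ _ df (deg_d dg) dh) (TE _ _ _ _ _ _ df dg (deg_d dh)).
by rewrite !oddzD !addbT.
Qed.

Lemma CHhom7_trilin x y z : trilin (CHhom7 x y z).
Proof.
apply: hom7_trilin.
- exact: Del_lin.
- exact: mul_lin_l.
- exact: mul_lin_r.
- exact: CHbrace_lin1.
- exact: CHbrace_lin2.
- exact: CHbrace_lin3.
- exact: homC_lin_l.
- exact: homC_lin_r.
- exact: homK_lin_l.
- exact: homK_lin_r.
Qed.

Lemma homotopic1_refl (e : int) Phi : homotopic1 hom d e Phi Phi.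
Proof.
exists (fun=> 0); split=> [a f g|n f _ s _|n f _]; rewrite ?scaler0 ?addr0 //.
by rewrite subrr (morph0 (linear_morph d_lin)).
Qed.

Lemma homotopic3_refl (e : int) Phi : homotopic3 hom d e Phi Phi.
Proof.
exists (fun _ _ _ => 0); split=> [|n m p f g h _ _ _ s _|n m p f g h _ _ _] //.
  by split=> ? ? ? ? ?; rewrite scaler0 addr0.
by rewrite subrr (morph0 (linear_morph d_lin)) !(scaler0, addr0).
Qed.

Lemma CH_BV : BV_up_to_homotopy hom d mul Del.
Proof.
split.
- exact: d_lin.
- by move=> n f; exact: deg_d.
- exact: d_d.
- by split=> [g|f]; [exact: mul_lin_l | exact: mul_lin_r].
- by move=> n m f g df dg; rewrite addr0; exact: deg_mul.
- by move=> n m f g df dg; rewrite signz_sg; apply: d_mul; exact: deg_parity.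
- exact: Del_lin.
- by move=> n f; exact: deg_Del.
- by move=> f; rewrite Del_d addNr.
(* Associativity is strict, so the zero homotopy suffices; the same applies to the square of [Del]
   below. *)
- rewrite (_ : (fun _ _ _ f g h => mul f (mul g h)) = fun _ _ _ f g h => mul (mul f g) h).
    exact: homotopic3_refl.
  by do 3!apply/funext=> ?; apply/funext=> f; apply/funext=> g; apply/funext=> h;
    rewrite CHcup_assoc.
- apply: (homotopic2_parity (H := homC)).
  + by split=> [g|f]; [exact: homC_lin_l | exact: homC_lin_r].
  + by move=> x y n m f g; rewrite sub0r; exact: deg_homC.
  move=> n m f g df dg; rewrite (d_homC (deg_parity df) (deg_parity dg)) signz_sg oddzM /=.
  by abel.
- rewrite (_ : (fun _ f => Del (Del f)) = fun _ _ => 0); first exact: homotopic1_refl.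
  by apply/funext=> n; apply/funext=> f; exact: Del_Del.
- apply: (homotopic3_parity (H := CHhom7)).
  + exact: CHhom7_trilin.
  + by move=> x y z n m p f g h; exact: deg_CHhom7.
  move=> n m p f g h df dg dh.
  (* The relation has the odd degree -1, which accounts for the minus sign in front of the terms
     with [d] inside in [d_CHhom7]. *)
  rewrite (_ : oddz (-1) = true) // -d_CHhom7; try exact: deg_parity.
  by rewrite !signz_sg !oddzM !oddzD addbT.
Qed.

End Form.
End CH.

Theorem corollary3p6 (k : fieldType) (A : falgType k) (eta : {symmetric A})
    (eta_nondegenerate : nondegenerate eta)
    (eta_invariant : forall a b c : A, eta (a * b) c = eta a (b * c)) :
  BV_up_to_homotopy (@CHdeg k A) (@CHdiff k A) (@CHcup k A) (CHDelta eta).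
Proof. exact: CH_BV. Qed.
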